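(* There is an absolute constant $C>0$ such that the following holds. Let $X>0$ be real, $a_1,a_2\in\mathbb Z$, $q\in\mathbb N$, $\alpha_1,\alpha_2\in\mathbb R$, and put $\beta_j=\alpha_j-a_j/q$ for $j=1,2$. Suppose that $|\beta_1|\le 1/(2q)$. Then $$\big|f(\alpha_1,\alpha_2)-q^{-1}S(q,a_1,a_2)I(\beta_1,\beta_2)\big|\le C\,(q,a_2)^{1/2}\big(q+qX^2|\beta_2|\big)^{1/2}\log(2q).$$
   Context: Write $e(\alpha)=\exp(2\pi\mathrm i\alpha)$ and let $(q,a_2)$ denote the greatest common divisor. Define $$f(\alpha_1,\alpha_2)=\sum_{1\le x\le X}e(\alpha_1x+\alpha_2x^2)$$ (sum over integers $x$), $$S(q,a_1,a_2)=\sum_{x=1}^q e\Big(\frac{a_1x+a_2x^2}{q}\Big),\qquad I(\beta_1,\beta_2)=\int_0^X e(\beta_1u+\beta_2u^2)\,\mathrm du.$$ *)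

(* Defs.v *)
From Stdlib Require Import Reals ZArith.
From Coquelicot Require Import Coquelicot.

Open Scope R_scope.

Definition Cexp (z : C) : C :=
  (RtoC (exp (Re z)) * (cos (Im z), sin (Im z)))%C.

Definition e (alpha : R) : C := Cexp (RtoC (2 * PI * alpha) * Ci)%C.

(* [Int_part X] is the floor of [X]; for [0 < X < 1] the range is empty and
   the sum is 0. *)
Definition weyl_sum (X alpha1 alpha2 : R) : C :=
  sum_n_m (fun x : nat => e (alpha1 * INR x + alpha2 * INR x ^ 2))
          1 (Z.to_nat (Int_part X)).

Definition gauss_sum (q : nat) (a1 a2 : Z) : C :=
  sum_n_m (fun x : nat => e ((IZR a1 * INR x + IZR a2 * INR x ^ 2) / INR q))
          1 q.

(* The structure is given explicitly because the canonical one on [C] has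
   complex scalars, whereas [RInt] needs a real normed module. *)
Definition weyl_int (X beta1 beta2 : R) : C :=
  RInt (V := C_R_CompleteNormedModule)
       (fun u : R => e (beta1 * u + beta2 * u ^ 2)) 0 X.

(* Main.v *)
Require Import Defs.
From Stdlib Require Import Reals ZArith Znumtheory Lra Lia Psatz.
From Coquelicot Require Import Coquelicot.

Open Scope R_scope.

(** Put [d = gcd (q, a2)] and [beta_j = alpha_j - a_j / q].  Additive characters
    modulo [q] complete the sum:
      q * f (alpha1, alpha2)
        = sum over b mod q of S (q, a1 + b, a2) * F (beta1 - b / q, beta2),
    where [F] is the quadratic sum without its arithmetic part
    ([qsum_completion]).  Squaring out a Gauss sum gives
    [|S (q, a, a2)|^2 <= 4 d q] for every [a] ([gauss_sum_bound]).

    Suppose first that the length [N] satisfies [N |beta2| <= 1 / (64 q)].  The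
    derivative of the phase then hardly moves.  For [b <> 0 mod q] it stays at
    distance at least a constant times [||b / q||] from the integers, so summation
    by parts bounds the corresponding [F] by a constant times [1 / ||b / q||]
    ([qsum_kusmin_landau]); these terms add up to [q log q].  For [b = 0] the
    derivative stays within [9 / 16] of zero, and [F (beta1, beta2)] differs from
    [I (beta1, beta2)] by a bounded amount ([qsum_minus_integral]).  Together this
    gives the theorem with error [sqrt (d q) log (2 q)] ([short_sum_approx]).

    Otherwise the allowed error contains the factor [N sqrt |beta2|], and both [f]
    and [S I / q] are at most that large.  For the integral this is the second
    derivative estimate [|I| <= 6 / sqrt |beta2|] ([weyl_int_bound]).  The sum is
    cut into pieces of equal length ([qsum_subdivide]).  Translating a piece
    changes [alpha1] but not [alpha2], so on each piece a numerator [a1] can be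
    chosen afresh with [|beta1| <= 1 / (2 q)].  If [|beta2|] is small compared with
    [1 / q^2], the pieces have length about [1 / (q |beta2|)] and the short case
    applies to each ([qsum_piece_small]).  If it is larger, they have length about
    [|beta2|^(-1/2)], which is [O(q)]; on such a piece the factor
    [e (beta1 x + beta2 x^2)] has bounded variation and is removed by partial
    summation from an incomplete Gauss sum ([qsum_piece_large]). *)

(** * Finite sums *)

(** Starting the index at 1 makes Gauss and Weyl sums instances by unfolding, and
    leaves [n = 0] as an honest empty sum. *)
Definition csum (f : nat -> C) (n : nat) : C := sum_n_m f 1 n.
Definition rsum (f : nat -> R) (n : nat) : R := sum_n_m f 1 n.

Lemma csum_0 f : csum f 0 = RtoC 0.
Proof. unfold csum. rewrite sum_n_m_zero; [reflexivity | lia]. Qed.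

Lemma csum_S f n : csum f (S n) = (csum f n + f (S n))%C.
Proof. unfold csum. rewrite sum_n_Sm; [reflexivity | lia]. Qed.

Lemma rsum_0 f : rsum f 0 = 0.
Proof. unfold rsum. rewrite sum_n_m_zero; [reflexivity | lia]. Qed.

Lemma rsum_S f n : rsum f (S n) = rsum f n + f (S n).
Proof. unfold rsum. rewrite sum_n_Sm; [reflexivity | lia]. Qed.

Lemma csum_ext f g n :
  (forall k, (1 <= k <= n)%nat -> f k = g k) -> csum f n = csum g n.
Proof. intros H. apply sum_n_m_ext_loc. exact H. Qed.

Lemma csum_plus f g n : csum (fun k => f k + g k)%C n = (csum f n + csum g n)%C.
Proof. apply (sum_n_m_plus (G := C_AbelianMonoid)). Qed.

Lemma csum_mult_l c f n : csum (fun k => c * f k)%C n = (c * csum f n)%C.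
Proof. apply (sum_n_m_mult_l (K := C_Ring)). Qed.

Lemma csum_const c n : csum (fun _ => c) n = (RtoC (INR n) * c)%C.
Proof.
  induction n as [|n IH].
  - rewrite csum_0. simpl. ring.
  - rewrite csum_S, IH, S_INR, RtoC_plus. ring.
Qed.

Lemma csum_switch (f : nat -> nat -> C) m n :
  csum (fun j => csum (f j) n) m = csum (fun k => csum (fun j => f j k) m) n.
Proof.
  induction m as [|m IH].
  - rewrite csum_0. rewrite (csum_ext _ (fun _ => RtoC 0)).
    + rewrite csum_const. ring.
    + intros k _. apply csum_0.
  - rewrite csum_S, IH, <- csum_plus. apply csum_ext.
    intros k _. now rewrite csum_S.
Qed.

Lemma csum_conj f n : Cconj (csum f n) = csum (fun k => Cconj (f k)) n.
Proof.
  induction n as [|n IH].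
  - rewrite !csum_0. unfold Cconj. simpl. now rewrite Ropp_0.
  - now rewrite !csum_S, Cplus_conj, IH.
Qed.

Lemma csum_Re f n : Re (csum f n) = rsum (fun k => Re (f k)) n.
Proof.
  induction n as [|n IH].
  - now rewrite csum_0, rsum_0.
  - rewrite csum_S, rsum_S, <- IH. reflexivity.
Qed.

Lemma csum_Im f n : Im (csum f n) = rsum (fun k => Im (f k)) n.
Proof.
  induction n as [|n IH].
  - now rewrite csum_0, rsum_0.
  - rewrite csum_S, rsum_S, <- IH. reflexivity.
Qed.

Lemma csum_add f n m :
  csum f (n + m) = (csum f n + csum (fun k => f (n + k)%nat) m)%C.
Proof.
  induction m as [|m IH].
  - rewrite csum_0, Nat.add_0_r. ring.
  - rewrite Nat.add_succ_r, !csum_S, IH, Nat.add_succ_r. ring.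
Qed.

(** A full period may start anywhere. *)
Lemma csum_period f q x :
  (forall k, f (k + q)%nat = f k) -> csum (fun k => f (x + k)%nat) q = csum f q.
Proof.
  intros Hf. induction x as [|x IH]; [reflexivity|].
  rewrite <- IH.
  assert (E := csum_add (fun k => f (x + k)%nat) 1 q).
  replace (1 + q)%nat with (S q) in E by lia.
  rewrite !csum_S, csum_0 in E.
  replace (x + S q)%nat with (x + 1 + q)%nat in E by lia.
  rewrite Hf in E.
  rewrite (csum_ext (fun k => f (S x + k)%nat) (fun k => f (x + (1 + k))%nat)).
  - transitivity ((RtoC 0 + f (x + 1)%nat +
      csum (fun k => f (x + (1 + k))%nat) q) - f (x + 1)%nat)%C; [ring|].
    rewrite <- E. ring.
  - intros k _. f_equal. lia.
Qed.

Lemma csum_triangle f n : Cmod (csum f n) <= rsum (fun k => Cmod (f k)) n.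
Proof.
  induction n as [|n IH].
  - rewrite csum_0, rsum_0, Cmod_0. lra.
  - rewrite csum_S, rsum_S. eapply Rle_trans; [apply Cmod_triangle|]. lra.
Qed.

Lemma rsum_le f g n :
  (forall k, (1 <= k <= n)%nat -> f k <= g k) -> rsum f n <= rsum g n.
Proof.
  induction n as [|n IH]; intros H.
  - rewrite !rsum_0. lra.
  - rewrite !rsum_S. specialize (H (S n)) as H1.
    assert (rsum f n <= rsum g n) by (apply IH; intros; apply H; lia).
    assert (f (S n) <= g (S n)) by (apply H1; lia). lra.
Qed.

Lemma rsum_ext f g n : (forall k, f k = g k) -> rsum f n = rsum g n.
Proof. apply sum_n_m_ext. Qed.

Lemma rsum_mult_l c f n : rsum (fun k => c * f k) n = c * rsum f n.
Proof.
  induction n as [|n IH].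
  - rewrite !rsum_0. ring.
  - rewrite !rsum_S, IH. ring.
Qed.

Lemma csum_bound f n M :
  (forall k, (1 <= k <= n)%nat -> Cmod (f k) <= M) -> Cmod (csum f n) <= INR n * M.
Proof.
  intros H. eapply Rle_trans; [apply csum_triangle|].
  eapply Rle_trans; [apply (rsum_le _ (fun _ => M)), H|].
  unfold rsum. rewrite sum_n_m_const. simpl Nat.sub. rewrite Nat.sub_0_r. lra.
Qed.

(** Abel summation against the partial sums of [c].  The hypotheses also cover the
    index [0], which does not occur in the sum: this makes the induction start
    from the empty sum, and the weights used below extend to [0]. *)
Lemma abel_bound (c w : nat -> C) n B W V :
  (forall j, (j <= n)%nat -> Cmod (csum c j) <= B) ->
  Cmod (w n) <= W ->
  (forall k, (k < n)%nat -> Cmod (w (S k) - w k)%C <= V) ->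
  Cmod (csum (fun k => w k * c k)%C n) <= B * (W + INR n * V).
Proof.
  intros HB HW HV.
  (* the deviation of the weighted sum from [csum c m * w m] grows by at
     most [B * V] at each step *)
  assert (D : forall m, (m <= n)%nat ->
    Cmod (csum (fun k => w k * c k)%C m - csum c m * w m)%C <= INR m * (B * V)).
  { induction m as [|m IH]; intros Hm.
    - rewrite !csum_0. simpl INR.
      replace (RtoC 0 - RtoC 0 * w 0%nat)%C with (RtoC 0) by ring.
      rewrite Cmod_0. lra.
    - rewrite !csum_S, S_INR.
      replace (csum (fun k => w k * c k) m + w (S m) * c (S m)
               - (csum c m + c (S m)) * w (S m))%C
        with ((csum (fun k => w k * c k) m - csum c m * w m)
              + - (csum c m * (w (S m) - w m)))%C by ring.
      eapply Rle_trans; [apply Cmod_triangle|].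
      rewrite Cmod_opp, Cmod_mult.
      assert (Cmod (csum c m) * Cmod (w (S m) - w m)%C <= B * V).
      { apply Rmult_le_compat; try apply Cmod_ge_0; [apply HB | apply HV]; lia. }
      assert (H1 := IH ltac:(lia)). lra. }
  replace (csum (fun k => w k * c k) n)%C
    with ((csum (fun k => w k * c k) n - csum c n * w n) + csum c n * w n)%C by ring.
  eapply Rle_trans; [apply Cmod_triangle|].
  rewrite (Cmod_mult (csum c n)).
  assert (Cmod (csum c n) * Cmod (w n) <= B * W).
  { apply Rmult_le_compat; try apply Cmod_ge_0; auto. }
  assert (H1 := D n ltac:(lia)). lra.
Qed.

(** * The additive character *)

Lemma e_eq t : e t = (cos (2 * PI * t), sin (2 * PI * t)).
Proof.
  unfold e, Cexp, Cmult, Re, Im. simpl.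
  replace (2 * PI * t * 0 - 0 * 1) with 0 by ring.
  replace (2 * PI * t * 1 + 0 * 0) with (2 * PI * t) by ring.
  rewrite exp_0. f_equal; ring.
Qed.

Lemma e_plus a b : e (a + b) = (e a * e b)%C.
Proof.
  rewrite !e_eq. unfold Cmult. simpl. rewrite Rmult_plus_distr_l, cos_plus, sin_plus.
  f_equal; ring.
Qed.

Lemma e_opp a : e (- a) = Cconj (e a).
Proof.
  rewrite !e_eq. unfold Cconj. simpl.
  replace (2 * PI * - a) with (- (2 * PI * a)) by ring.
  now rewrite cos_neg, sin_neg.
Qed.

Lemma e_0 : e 0 = RtoC 1.
Proof. rewrite e_eq, Rmult_0_r, cos_0, sin_0. reflexivity. Qed.

Lemma Cmod_e a : Cmod (e a) = 1.
Proof.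
  rewrite e_eq. unfold Cmod. simpl fst. simpl snd.
  assert (H := sin2_cos2 (2 * PI * a)). unfold Rsqr in H.
  replace (cos (2 * PI * a) ^ 2 + sin (2 * PI * a) ^ 2) with 1 by (simpl; lra).
  apply sqrt_1.
Qed.

Lemma e_INR n : e (INR n) = RtoC 1.
Proof.
  induction n as [|n IH].
  - apply e_0.
  - rewrite S_INR, e_plus, IH, e_eq, Rmult_1_r, cos_2PI, sin_2PI.
    change (1, 0) with (RtoC 1). ring.
Qed.

Lemma e_IZR z : e (IZR z) = RtoC 1.
Proof.
  destruct (Z_le_gt_dec 0 z) as [H|H].
  - rewrite <- (Z2Nat.id z H), <- INR_IZR_INZ. apply e_INR.
  - replace (IZR z) with (- IZR (- z)) by (rewrite opp_IZR; ring).
    rewrite e_opp, <- (Z2Nat.id (- z)) by lia.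
    rewrite <- INR_IZR_INZ, e_INR. unfold Cconj. simpl. now rewrite Ropp_0.
Qed.

Lemma e_plus_IZR a z : e (a + IZR z) = e a.
Proof. rewrite e_plus, e_IZR. ring. Qed.

Lemma Cmod_le_Re_Im z : Cmod z <= Rabs (Re z) + Rabs (Im z).
Proof.
  replace z with (RtoC (Re z) + RtoC (Im z) * Ci)%C at 1.
  - eapply Rle_trans; [apply Cmod_triangle|].
    rewrite Cmod_mult, Cmod_Ci, !Cmod_R. lra.
  - destruct z as [a b]. unfold Cplus, Cmult, Re, Im. simpl. f_equal; ring.
Qed.

Lemma cos_lipschitz a b : Rabs (cos a - cos b) <= Rabs (a - b).
Proof.
  destruct (MVT_gen cos b a (fun x => - sin x)) as (c & _ & Hc).
  - intros x _. auto_derive; [trivial | ring].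
  - intros x _. apply continuity_cos.
  - rewrite Hc, Rabs_mult, Rabs_Ropp.
    assert (Rabs (sin c) <= 1) by (apply Rabs_le, SIN_bound).
    assert (HP := Rabs_pos (a - b)). nra.
Qed.

Lemma sin_lipschitz a b : Rabs (sin a - sin b) <= Rabs (a - b).
Proof.
  rewrite <- !cos_shift.
  eapply Rle_trans; [apply cos_lipschitz|].
  right. rewrite <- Rabs_Ropp. f_equal. ring.
Qed.

(** The constant is not sharp ([2 * PI] would do); [16] results from bounding the
    two coordinates separately, with [PI <= 4]. *)
Lemma e_lipschitz a b : Cmod (e a - e b)%C <= 16 * Rabs (a - b).
Proof.
  eapply Rle_trans; [apply Cmod_le_Re_Im|].
  rewrite !e_eq. unfold Cminus, Cplus, Copp, Re, Im. simpl.
  assert (H1 := cos_lipschitz (2 * PI * a) (2 * PI * b)).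
  assert (H2 := sin_lipschitz (2 * PI * a) (2 * PI * b)).
  replace (2 * PI * a - 2 * PI * b) with (2 * PI * (a - b)) in H1, H2 by ring.
  rewrite Rabs_mult, (Rabs_pos_eq (2 * PI)) in H1, H2 by (assert (H := PI_RGT_0); lra).
  assert (H3 := Rabs_pos (a - b)). assert (H4 := PI_4). unfold Rminus in *. nra.
Qed.

Lemma one_minus_e t :
  (RtoC 1 - e (- t))%C = (RtoC (2 * sin (PI * t)) * Ci * e (- (t / 2)))%C.
Proof.
  rewrite !e_eq.
  replace (2 * PI * - (t / 2)) with (- (PI * t)) by field.
  replace (2 * PI * - t) with (- (2 * (PI * t))) by ring.
  rewrite !cos_neg, !sin_neg, cos_2a_sin, sin_2a.
  unfold Cminus, Cplus, Copp, Cmult, RtoC, Ci. simpl. f_equal; ring.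
Qed.

Lemma Cmod_one_minus_e t : Cmod (RtoC 1 - e (- t))%C = 2 * Rabs (sin (PI * t)).
Proof.
  rewrite one_minus_e, !Cmod_mult, Cmod_e, Cmod_Ci, Cmod_R, Rabs_mult.
  rewrite (Rabs_pos_eq 2) by lra. ring.
Qed.

Lemma sin_lower t : 0 <= t -> t <= 4 -> t - t ^ 3 / 6 <= sin t.
Proof.
  intros H0 H4. destruct (pre_sin_bound t 0 H0 H4) as [H _].
  eapply Rle_trans; [|exact H]. unfold sin_approx, sin_term. simpl. right. field.
Qed.

(** This is [|1 - e (s)| >= 2 ||s||], the form in which the distance of a phase
    derivative to the integers enters.  On [0, 1/2] it follows from the cubic
    Taylor bound, and the other half is its mirror image. *)
Lemma sin_PI_lower s : 0 <= s -> s <= 1 -> Rmin s (1 - s) <= sin (PI * s).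
Proof.
  assert (HP := PI_4). assert (HP3 := PI2_3_2).
  assert (half : forall r, 0 <= r -> r <= 1 / 2 -> r <= sin (PI * r)).
  { intros r H0 H1.
    assert (L : PI * r - (PI * r) ^ 3 / 6 <= sin (PI * r)) by (apply sin_lower; nra).
    assert (A : 0 <= PI * r <= 2) by nra.
    assert (3 * r <= PI * r) by nra.
    assert (B : (PI * r) ^ 2 <= 4) by nra.
    assert ((PI * r) ^ 3 <= 4 * (PI * r)).
    { replace ((PI * r) ^ 3) with ((PI * r) ^ 2 * (PI * r)) by ring.
      apply Rmult_le_compat_r; lra. }
    lra. }
  intros H0 H1. destruct (Rle_dec s (1 / 2)) as [H|H].
  - rewrite Rmin_left by lra. now apply half.
  - rewrite Rmin_right by lra.
    replace (PI * s) with (PI - PI * (1 - s)) by ring.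
    rewrite sin_PI_x. apply half; lra.
Qed.

(** * Quadratic exponential sums by partial summation *)

Definition qsum (c1 c2 : R) (n : nat) : C :=
  csum (fun x => e (c1 * INR x + c2 * INR x ^ 2)) n.

(** The backward difference of [c1 * x + c2 * x ^ 2] at [x = k]. *)
Definition qdiff (c1 c2 : R) (k : nat) : R := c1 + c2 * (2 * INR k - 1).

Lemma qdiff_step c1 c2 k : qdiff c1 c2 (S k) - qdiff c1 c2 k = 2 * c2.
Proof. unfold qdiff. rewrite S_INR. ring. Qed.

Lemma qdiff_near c1 c2 k n :
  (k <= n)%nat -> (1 <= n)%nat -> Rabs (qdiff c1 c2 k - c1) <= 2 * (INR n * Rabs c2).
Proof.
  intros Hk Hn. unfold qdiff.
  replace (c1 + c2 * (2 * INR k - 1) - c1) with ((2 * INR k - 1) * c2) by ring.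
  rewrite Rabs_mult, <- Rmult_assoc. apply Rmult_le_compat_r; [apply Rabs_pos|].
  apply le_INR in Hk. apply le_INR in Hn. simpl in Hn.
  assert (H := pos_INR k). apply Rabs_le. lra.
Qed.

(** With [g k = e (c1 * k + c2 * k ^ 2)], the factor [(1 - e (- qdiff k)) * g k] is
    the difference [g k - g (k - 1)], so its partial sums are bounded by [2]: a
    quadratic sum whose terms are divisible by [1 - e (- qdiff k)] with a smooth
    quotient [w] is as small as the variation of [w]. *)
Lemma qsum_by_parts c1 c2 (w : nat -> C) n W V :
  Cmod (w n) <= W ->
  (forall k, (k < n)%nat -> Cmod (w (S k) - w k)%C <= V) ->
  Cmod (csum (fun k => w k * ((RtoC 1 - e (- qdiff c1 c2 k))
                              * e (c1 * INR k + c2 * INR k ^ 2)))%C n)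
  <= 2 * (W + INR n * V).
Proof.
  intros HW HV. apply (abel_bound _ w); auto.
  intros j _.
  assert (E : csum (fun k => (RtoC 1 - e (- qdiff c1 c2 k))
                             * e (c1 * INR k + c2 * INR k ^ 2))%C j
              = (e (c1 * INR j + c2 * INR j ^ 2) - RtoC 1)%C).
  { induction j as [|j IH].
    - rewrite csum_0. simpl INR.
      replace (c1 * 0 + c2 * 0 ^ 2) with 0 by ring. rewrite e_0. ring.
    - rewrite csum_S, IH.
      replace (c1 * INR j + c2 * INR j ^ 2)
        with (- qdiff c1 c2 (S j) + (c1 * INR (S j) + c2 * INR (S j) ^ 2))
        by (unfold qdiff; rewrite S_INR; ring).
      rewrite e_plus. ring. }
  rewrite E. eapply Rle_trans; [apply Cmod_triangle|].
  rewrite Cmod_opp, Cmod_e, Cmod_1. lra.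
Qed.

Lemma Cmod_inv_sub a b mu :
  0 < mu -> mu <= Cmod a -> mu <= Cmod b ->
  Cmod (/ a - / b)%C <= Cmod (b - a)%C / mu ^ 2.
Proof.
  intros Hmu Ha Hb.
  assert (a <> RtoC 0) by (apply Cmod_gt_0; lra).
  assert (b <> RtoC 0) by (apply Cmod_gt_0; lra).
  replace (/ a - / b)%C with ((b - a) * (/ a * / b))%C by (field; auto).
  rewrite !Cmod_mult, !Cmod_inv by auto.
  apply Rmult_le_compat_l; [apply Cmod_ge_0|].
  replace (/ mu ^ 2) with (/ mu * / mu) by (field; lra).
  assert (/ Cmod a <= / mu) by (apply Rinv_le_contravar; lra).
  assert (/ Cmod b <= / mu) by (apply Rinv_le_contravar; lra).
  apply Rmult_le_compat; try (apply Rlt_le, Rinv_0_lt_compat; lra); auto.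
Qed.

(** The weight is [1 / (1 - e (- qdiff k))].  Its variation is estimated by the
    Lipschitz bound rather than by monotonicity of the cotangent, which costs
    the second term; that term is harmless because the sums to which this is
    applied have [n * |c2|] at most of the order of [mu]. *)
Lemma qsum_kusmin_landau c1 c2 n mu :
  0 < mu ->
  (forall k, (k <= n)%nat -> mu <= Cmod (RtoC 1 - e (- qdiff c1 c2 k))%C) ->
  Cmod (qsum c1 c2 n) <= 2 * (/ mu + INR n * (32 * Rabs c2 / mu ^ 2)).
Proof.
  intros Hmu H.
  set (w := fun k => (/ (RtoC 1 - e (- qdiff c1 c2 k)))%C).
  assert (nz : forall k, (k <= n)%nat -> (RtoC 1 - e (- qdiff c1 c2 k))%C <> RtoC 0).
  { intros k Hk. apply Cmod_gt_0. specialize (H k Hk). lra. }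
  unfold qsum. rewrite (csum_ext _ (fun k => w k * ((RtoC 1 - e (- qdiff c1 c2 k))
                              * e (c1 * INR k + c2 * INR k ^ 2)))%C).
  - apply qsum_by_parts; unfold w.
    + rewrite Cmod_inv by auto. apply Rinv_le_contravar; auto.
    + intros k Hk. eapply Rle_trans; [apply (Cmod_inv_sub _ _ mu); auto; apply H; lia|].
      apply Rmult_le_compat_r.
      { apply Rlt_le, Rinv_0_lt_compat. nra. }
      replace (RtoC 1 - e (- qdiff c1 c2 k) - (RtoC 1 - e (- qdiff c1 c2 (S k))))%C
        with (e (- qdiff c1 c2 (S k)) - e (- qdiff c1 c2 k))%C by ring.
      eapply Rle_trans; [apply e_lipschitz|].
      replace (- qdiff c1 c2 (S k) - - qdiff c1 c2 k)
        with (- (qdiff c1 c2 (S k) - qdiff c1 c2 k)) by ring.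
      rewrite qdiff_step, Rabs_Ropp, Rabs_mult, (Rabs_pos_eq 2) by lra. lra.
  - intros k Hk. unfold w. field. apply nz. lia.
Qed.

(** The integral represents [sin t / t] without a case distinction at [t = 0], and
    makes its Lipschitz bound immediate. *)
Definition sinc (t : R) : R := RInt (fun u => cos (t * u)) 0 1.

Lemma is_RInt_sinc t : is_RInt (fun u => cos (t * u)) 0 1 (sinc t).
Proof.
  apply (RInt_correct (V := R_CompleteNormedModule)).
  apply (ex_RInt_continuous (V := R_CompleteNormedModule)). intros u _.
  apply (ex_derive_continuous (V := R_NormedModule)). auto_derive. trivial.
Qed.

Lemma sinc_mult t : t * sinc t = sin t.
Proof.
  assert (H : is_RInt (fun u => t * cos (t * u)) 0 1 (sin (t * 1) - sin (t * 0))).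
  { apply (is_RInt_derive (V := R_CompleteNormedModule) (fun u => sin (t * u))).
    - intros u _. auto_derive; [trivial | ring].
    - intros u _. apply (ex_derive_continuous (V := R_NormedModule)).
      auto_derive. trivial. }
  assert (H1 := is_RInt_scal _ _ _ t _ (is_RInt_sinc t)).
  assert (U := is_RInt_unique (V := R_CompleteNormedModule) _ _ _ _ H).
  assert (U1 := is_RInt_unique (V := R_CompleteNormedModule) _ _ _ _ H1).
  transitivity (sin (t * 1) - sin (t * 0)).
  - rewrite <- U. symmetry. exact U1.
  - rewrite Rmult_0_r, sin_0, Rmult_1_r. ring.
Qed.

Lemma sinc_lipschitz t s : Rabs (sinc t - sinc s) <= Rabs (t - s).
Proof.
  assert (H := is_RInt_minus _ _ _ _ _ _ (is_RInt_sinc t) (is_RInt_sinc s)).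
  assert (H1 := is_RInt_const (V := R_CompleteNormedModule) 0 1 (Rabs (t - s))).
  assert (L := fun h => norm_RInt_le _ _ 0 1 _ _ ltac:(lra) h H H1).
  replace (Rabs (t - s)) with (scal (1 - 0) (Rabs (t - s))).
  - apply L. intros u Hu. eapply Rle_trans; [apply cos_lipschitz|].
    replace (t * u - s * u) with ((t - s) * u) by ring.
    rewrite Rabs_mult, (Rabs_pos_eq u) by lra. assert (H2 := Rabs_pos (t - s)). nra.
  - unfold scal. simpl. unfold mult. simpl. ring.
Qed.

(** The Taylor bound [1 - t^2 / 6] exceeds [1 / 8] up to [t = 9 / 4].  That range is
    chosen to contain [PI * delta] for [|delta| <= 9 / 16], using only [PI <= 4]. *)
Lemma sinc_lower t : Rabs t <= 9 / 4 -> 1 / 8 <= sinc t.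
Proof.
  assert (pos : forall s, 0 < s -> s <= 9 / 4 -> 1 / 8 <= sinc s).
  { intros s H0 H1. assert (L := sin_lower s ltac:(lra) ltac:(lra)).
    rewrite <- sinc_mult in L.
    apply (Rmult_le_reg_l s); [lra|].
    assert (A : s ^ 2 <= 81 / 16) by nra.
    assert (s ^ 3 <= 81 / 16 * s).
    { replace (s ^ 3) with (s ^ 2 * s) by ring. apply Rmult_le_compat_r; lra. }
    lra. }
  intros H. destruct (Rtotal_order t 0) as [H0|[H0|H0]].
  - replace (sinc t) with (sinc (- t)).
    + apply pos; [lra|]. rewrite Rabs_left in H; lra.
    + apply RInt_ext. intros u _.
      replace (- t * u) with (- (t * u)) by ring. apply cos_neg.
  - subst t. unfold sinc. rewrite (RInt_ext _ (fun _ => 1)).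
    + rewrite RInt_const. unfold scal. simpl. unfold mult. simpl. lra.
    + intros u _. rewrite Rmult_0_l. apply cos_0.
  - apply pos; [lra|]. rewrite Rabs_pos_eq in H; lra.
Qed.

(** The bound depends on [n] only through the variation [n * |c2|] of the phase
    derivative, although the [n] terms may have constant size: [2 PI i delta / (1 - e (- delta))] is the
    smooth function [e (delta / 2) / sinc (PI delta)], so the terms are divisible
    by [1 - e (- delta)] even where [delta] vanishes. *)
Lemma qsum_weighted c1 c2 n :
  (forall k, (k <= n)%nat -> Rabs (qdiff c1 c2 k) <= 9 / 16) ->
  Cmod (csum (fun k => RtoC (2 * PI * qdiff c1 c2 k)
                       * e (c1 * INR k + c2 * INR k ^ 2))%C n)
  <= 16 + 1280 * (INR n * Rabs c2).
Proof.
  intros H.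
  set (s := fun k => sinc (PI * qdiff c1 c2 k)).
  assert (HP := PI_4). assert (HP0 := PI_RGT_0).
  assert (Hs : forall k, (k <= n)%nat -> 1 / 8 <= s k).
  { intros k Hk. apply sinc_lower. rewrite Rabs_mult, (Rabs_pos_eq PI) by lra.
    specialize (H k Hk). assert (H1 := Rabs_pos (qdiff c1 c2 k)). nra. }
  set (w := fun k => (RtoC (/ s k) * (- Ci * e (qdiff c1 c2 k / 2)))%C).
  assert (Hi : forall k, (k <= n)%nat -> 0 < / s k <= 8).
  { intros k Hk. specialize (Hs k Hk). split; [apply Rinv_0_lt_compat; lra|].
    replace 8 with (/ (1 / 8)) by field. apply Rinv_le_contravar; lra. }
  rewrite (csum_ext _ (fun k => w k * ((RtoC 1 - e (- qdiff c1 c2 k))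
                              * e (c1 * INR k + c2 * INR k ^ 2)))%C).
  - replace (16 + 1280 * (INR n * Rabs c2))
      with (2 * (8 + INR n * (640 * Rabs c2))) by ring.
    apply qsum_by_parts; unfold w.
    + rewrite !Cmod_mult, Cmod_opp, Cmod_Ci, Cmod_e, Cmod_R.
      destruct (Hi n (le_n n)). rewrite Rabs_pos_eq; lra.
    + intros k Hk.
      replace (RtoC (/ s (S k)) * (- Ci * e (qdiff c1 c2 (S k) / 2))
               - RtoC (/ s k) * (- Ci * e (qdiff c1 c2 k / 2)))%C
        with (- Ci * (RtoC (/ s (S k)) * (e (qdiff c1 c2 (S k) / 2) - e (qdiff c1 c2 k / 2))
              + RtoC (/ s (S k) - / s k) * e (qdiff c1 c2 k / 2)))%C
        by (rewrite RtoC_minus; ring).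
      rewrite Cmod_mult, Cmod_opp, Cmod_Ci, Rmult_1_l.
      eapply Rle_trans; [apply Cmod_triangle|].
      rewrite !Cmod_mult, Cmod_e, !Cmod_R, Rmult_1_r.
      assert (I1 := Hi k ltac:(lia)). assert (I2 := Hi (S k) ltac:(lia)).
      rewrite (Rabs_pos_eq (/ s (S k))) by lra.
      assert (L1 := e_lipschitz (qdiff c1 c2 (S k) / 2) (qdiff c1 c2 k / 2)).
      replace (qdiff c1 c2 (S k) / 2 - qdiff c1 c2 k / 2) with c2 in L1
        by (assert (D := qdiff_step c1 c2 k); lra).
      assert (L2 := sinc_lipschitz (PI * qdiff c1 c2 k) (PI * qdiff c1 c2 (S k))).
      fold (s k) in L2. fold (s (S k)) in L2.
      replace (PI * qdiff c1 c2 k - PI * qdiff c1 c2 (S k)) with (- (2 * PI * c2)) in L2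
        by (assert (D := qdiff_step c1 c2 k); nra).
      rewrite Rabs_Ropp, Rabs_mult, (Rabs_pos_eq (2 * PI)) in L2 by lra.
      assert (N1 := Hs k ltac:(lia)). assert (N2 := Hs (S k) ltac:(lia)).
      replace (/ s (S k) - / s k) with ((s k - s (S k)) * (/ s (S k) * / s k))
        by (field; lra).
      rewrite Rabs_mult, (Rabs_pos_eq (/ s (S k) * / s k)) by nra.
      assert (P := Rabs_pos c2). assert (M := Cmod_ge_0 (e (qdiff c1 c2 (S k) / 2) - e (qdiff c1 c2 k / 2))%C).
      assert (T1 : / s (S k) * Cmod (e (qdiff c1 c2 (S k) / 2) - e (qdiff c1 c2 k / 2))%C
                   <= 8 * (16 * Rabs c2)) by (apply Rmult_le_compat; lra).
      assert (T2 : Rabs (s k - s (S k)) * (/ s (S k) * / s k) <= (8 * Rabs c2) * (8 * 8)).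
      { apply Rmult_le_compat; [apply Rabs_pos | nra | nra |].
        apply Rmult_le_compat; lra. }
      lra.
  - intros k Hk. unfold w. rewrite one_minus_e.
    assert (E := sinc_mult (PI * qdiff c1 c2 k)). fold (s k) in E. rewrite <- E.
    replace (RtoC (/ s k) * (- Ci * e (qdiff c1 c2 k / 2)) *
     (RtoC (2 * (PI * qdiff c1 c2 k * s k)) * Ci * e (- (qdiff c1 c2 k / 2)) *
      e (c1 * INR k + c2 * INR k ^ 2)))%C
     with (- (Ci * Ci) * (RtoC (/ s k) * RtoC (2 * (PI * qdiff c1 c2 k * s k))) *
       (e (qdiff c1 c2 k / 2) * e (- (qdiff c1 c2 k / 2)))
       * e (c1 * INR k + c2 * INR k ^ 2))%C by ring.
    rewrite <- e_plus, <- RtoC_mult, Rplus_opp_r, e_0.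
    replace (Ci * Ci)%C with (RtoC (-1)).
    2:{ unfold Cmult, Ci, RtoC. simpl. f_equal; ring. }
    replace (/ s k * (2 * (PI * qdiff c1 c2 k * s k))) with (2 * PI * qdiff c1 c2 k).
    2:{ field. specialize (Hs k ltac:(lia)). lra. }
    change (-1) with (- (1)). rewrite RtoC_opp. ring.
Qed.

(** * Oscillatory integrals with quadratic phase *)

Definition qcos (c0 c1 c2 u : R) : R := cos (2 * PI * (c0 + c1 * u + c2 * u ^ 2)).

Definition qcos_int (c0 c1 c2 y : R) : R := RInt (qcos c0 c1 c2) 0 y.

Lemma qcos_derive c0 c1 c2 u :
  is_derive (qcos c0 c1 c2) u
    (- (2 * PI * (c1 + 2 * c2 * u)) * sin (2 * PI * (c0 + c1 * u + c2 * u ^ 2))).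
Proof. unfold qcos. auto_derive; [trivial | simpl; ring]. Qed.

Lemma qcos_continuous c0 c1 c2 u : continuous (qcos c0 c1 c2) u.
Proof.
  apply (ex_derive_continuous (V := R_NormedModule)). eexists. apply qcos_derive.
Qed.

Lemma is_RInt_qcos c0 c1 c2 y : is_RInt (qcos c0 c1 c2) 0 y (qcos_int c0 c1 c2 y).
Proof.
  apply (RInt_correct (V := R_CompleteNormedModule)).
  apply (ex_RInt_continuous (V := R_CompleteNormedModule)). intros u _.
  apply qcos_continuous.
Qed.

Lemma qcos_int_derive c0 c1 c2 y :
  is_derive (qcos_int c0 c1 c2) y (qcos c0 c1 c2 y).
Proof.
  apply (is_derive_RInt (V := R_CompleteNormedModule) (qcos c0 c1 c2) _ 0 y).
  - apply filter_forall. intros x. apply is_RInt_qcos.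
  - apply qcos_continuous.
Qed.

Lemma qcos_int_0 c0 c1 c2 : qcos_int c0 c1 c2 0 = 0.
Proof. apply (RInt_point (V := R_CompleteNormedModule)). Qed.

(** The imaginary part is the same cosine with its phase shifted by a quarter turn,
    so that all estimates need only be proved for real cosines. *)
Lemma e_qcos c1 c2 u :
  e (c1 * u + c2 * u ^ 2) = (qcos 0 c1 c2 u, qcos (- (1 / 4)) c1 c2 u).
Proof.
  rewrite e_eq. unfold qcos. f_equal.
  - do 2 f_equal. ring.
  - rewrite <- cos_shift, <- cos_neg. f_equal. field.
Qed.

Lemma weyl_int_eq y c1 c2 :
  weyl_int y c1 c2 = (qcos_int 0 c1 c2 y, qcos_int (- (1 / 4)) c1 c2 y).
Proof.
  apply (is_RInt_unique (V := C_R_CompleteNormedModule)).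
  apply (is_RInt_fct_extend_pair (U := R_NormedModule) (V := R_NormedModule)).
  - apply (is_RInt_ext (qcos 0 c1 c2)); [|apply is_RInt_qcos].
    intros u _. now rewrite e_qcos.
  - apply (is_RInt_ext (qcos (- (1 / 4)) c1 c2)); [|apply is_RInt_qcos].
    intros u _. now rewrite e_qcos.
Qed.

(** For either sign [s], the function [g - s * f] is nondecreasing. *)
Lemma derive_le_increasing (f g df dg : R -> R) a b :
  a <= b ->
  (forall u, a <= u <= b -> is_derive f u (df u)) ->
  (forall u, a <= u <= b -> is_derive g u (dg u)) ->
  (forall u, a <= u <= b -> Rabs (df u) <= dg u) ->
  Rabs (f b - f a) <= g b - g a.
Proof.
  intros Hab Hf Hg Hle.
  assert (S : forall s, Rabs s = 1 -> s * (f b - f a) <= g b - g a).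
  { intros s Hs.
    destruct (MVT_gen (fun u => g u - s * f u) a b (fun u => dg u - s * df u))
      as (c & Hc & E).
    - intros x Hx. rewrite Rmin_left, Rmax_right in Hx by lra.
      apply (is_derive_minus (V := R_NormedModule) g (fun u => s * f u)); [apply Hg; lra|].
      apply (is_derive_scal f x s (df x)); apply Hf; lra.
    - intros x Hx. rewrite Rmin_left, Rmax_right in Hx by lra.
      apply continuity_pt_filterlim.
      apply (ex_derive_continuous (V := R_NormedModule) (fun u => g u - s * f u) x).
      exists (dg x - s * df x). apply (is_derive_minus (V := R_NormedModule) g (fun u => s * f u)); [apply Hg; lra|].
      apply (is_derive_scal f x s (df x)); apply Hf; lra.
    - rewrite Rmin_left, Rmax_right in Hc by lra.
      assert (L := Hle c Hc).
      assert (s * df c <= Rabs (df c)).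
      { eapply Rle_trans; [apply Rle_abs|]. rewrite Rabs_mult, Hs. lra. }
      nra. }
  apply Rabs_le.
  assert (S1 := S 1 Rabs_R1).
  assert (S2 := S (-1) ltac:(rewrite Rabs_left; lra)). lra.
Qed.

Lemma qcos_int_lipschitz c0 c1 c2 a b :
  a <= b -> Rabs (qcos_int c0 c1 c2 b - qcos_int c0 c1 c2 a) <= b - a.
Proof.
  intros H. apply (derive_le_increasing _ (fun u => u) (qcos c0 c1 c2) (fun _ => 1)); auto.
  - intros u _. apply qcos_int_derive.
  - intros u _. apply (is_derive_id (K := R_AbsRing)).
  - intros u _. apply Rabs_le, COS_bound.
Qed.

(** Integration by parts turns the integral into the boundary values of
    [sin / (2 PI psi)], with [psi] the derivative of the phase, plus an integral
    against the derivative of [1 / psi].  The hypothesis prevents [psi] from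
    vanishing, so [1 / psi] is monotone and its variation is again given by
    boundary values. *)
Lemma qcos_int_first_derivative c0 c1 c2 a b lam :
  a <= b -> 0 < lam ->
  (forall u, a <= u <= b -> lam <= Rabs (c1 + 2 * c2 * u)) ->
  Rabs (qcos_int c0 c1 c2 b - qcos_int c0 c1 c2 a) <= / lam.
Proof.
  intros Hab Hlam H.
  assert (HP := PI2_3_2). assert (HP0 := PI_RGT_0).
  set (psi := fun u => c1 + 2 * c2 * u).
  set (th := fun u => 2 * PI * (c0 + c1 * u + c2 * u ^ 2)).
  set (s := sign c2).
  assert (Hs : Rabs s <= 1).
  { unfold s. destruct (Rtotal_order c2 0) as [L|[L|L]].
    - rewrite sign_eq_m1 by lra. rewrite Rabs_left; lra.
    - rewrite L, sign_0, Rabs_R0; lra.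
    - rewrite sign_eq_1, Rabs_R1 by lra; lra. }
  assert (Hs2 : s * c2 = Rabs c2).
  { unfold s. destruct (Rtotal_order c2 0) as [L|[L|L]].
    - rewrite sign_eq_m1 by lra. rewrite Rabs_left; lra.
    - rewrite L, sign_0, Rabs_R0; lra.
    - rewrite sign_eq_1, Rabs_pos_eq by lra; lra. }
  assert (nz : forall u, a <= u <= b -> psi u <> 0).
  { intros u Hu E. specialize (H u Hu). fold (psi u) in H. rewrite E, Rabs_R0 in H. lra. }
  assert (ib : forall u, a <= u <= b -> Rabs (/ psi u) <= / lam).
  { intros u Hu. rewrite Rabs_inv. apply Rinv_le_contravar; auto. now apply H. }
  assert (small : forall u z, a <= u <= b -> Rabs z <= 1 ->
    Rabs (z * (/ psi u) / (2 * PI)) <= / lam / 4).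
  { intros u z Hu Hz. specialize (ib u Hu).
    unfold Rdiv at 1. rewrite !Rabs_mult, (Rabs_inv (2 * PI)), (Rabs_pos_eq (2 * PI)) by lra.
    assert (/ (2 * PI) <= / 4) by (apply Rinv_le_contravar; lra).
    assert (0 < / (2 * PI)) by (apply Rinv_0_lt_compat; lra).
    assert (A : Rabs z * Rabs (/ psi u) <= 1 * / lam)
      by (apply Rmult_le_compat; auto using Rabs_pos).
    unfold Rdiv. rewrite <- (Rmult_1_l (/ lam)).
    apply Rmult_le_compat; try lra. apply Rmult_le_pos; apply Rabs_pos. }
  assert (D := derive_le_increasing
    (fun u => qcos_int c0 c1 c2 u - sin (th u) * (/ psi u) / (2 * PI))
    (fun u => - (s * (/ psi u) / (2 * PI)))
    (fun u => sin (th u) * (2 * c2 / psi u ^ 2) / (2 * PI))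
    (fun u => 2 * Rabs c2 / psi u ^ 2 / (2 * PI)) a b Hab).
  simpl in D.
  assert (D' : Rabs (qcos_int c0 c1 c2 b - sin (th b) * / psi b / (2 * PI) -
       (qcos_int c0 c1 c2 a - sin (th a) * / psi a / (2 * PI))) <=
     - (s * / psi b / (2 * PI)) - - (s * / psi a / (2 * PI))).
  { apply D.
    - intros u Hu.
      evar_last.
      + apply (is_derive_minus (V := R_NormedModule) (qcos_int c0 c1 c2)
            (fun u => sin (th u) * (/ psi u) / (2 * PI))); [apply qcos_int_derive|].
        unfold th, psi. auto_derive; [exact (nz u Hu) | reflexivity].
      + unfold minus, plus, opp, qcos. simpl. specialize (nz u Hu). unfold psi in nz |- *.
        unfold th. simpl. field. split; lra.
    - intros u Hu. rewrite <- Hs2. unfold psi. specialize (nz u Hu). unfold psi in nz.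
      auto_derive; [auto|]. field. split; lra.
    - intros u Hu. specialize (nz u Hu).
      assert (0 < psi u ^ 2) by (assert (0 <= psi u ^ 2) by nra;
        assert (psi u ^ 2 <> 0) by (apply pow_nonzero; auto); lra).
      replace (sin (th u) * (2 * c2 / (psi u * (psi u * 1))) / (2 * PI))
        with (sin (th u) * c2 * (/ (psi u ^ 2) / PI)) by (field; split; lra).
      replace (2 * Rabs c2 / (psi u * (psi u * 1)) / (2 * PI))
        with (1 * Rabs c2 * (/ (psi u ^ 2) / PI)) by (field; split; lra).
      assert (0 <= / (psi u ^ 2) / PI).
      { apply Rmult_le_pos; apply Rlt_le, Rinv_0_lt_compat; lra. }
      rewrite !Rabs_mult, (Rabs_pos_eq (/ psi u ^ 2 / PI)) by auto.
      apply Rmult_le_compat_r; auto. apply Rmult_le_compat_r; [apply Rabs_pos|].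
      apply Rabs_le, SIN_bound. }
  clear D.
  assert (B1 := small a s ltac:(lra) Hs). assert (B2 := small b s ltac:(lra) Hs).
  assert (Hsin : forall x, Rabs (sin x) <= 1) by (intros; apply Rabs_le, SIN_bound).
  assert (B3 := small a _ ltac:(lra) (Hsin (th a))).
  assert (B4 := small b _ ltac:(lra) (Hsin (th b))).
  apply Rabs_le_between in B1, B2, B3, B4, D'. apply Rabs_le. lra.
Qed.

(** Within [1 / (2 sqrt |c2|)] of the stationary point [u0] the trivial bound is used;
    outside, the derivative of the phase is at least [sqrt |c2|].  The three
    pieces contribute [1 / sqrt |c2|] each. *)
Lemma qcos_int_second_derivative c0 c1 c2 y :
  0 <= y -> c2 <> 0 -> Rabs (qcos_int c0 c1 c2 y) <= 3 / sqrt (Rabs c2).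
Proof.
  intros Hy Hc.
  assert (Hc' : 0 < Rabs c2) by now apply Rabs_pos_lt.
  set (lam := sqrt (Rabs c2)).
  assert (Hl : 0 < lam) by now apply sqrt_lt_R0.
  assert (Hl2 : lam * lam = Rabs c2) by (apply sqrt_sqrt; lra).
  set (u0 := - c1 / (2 * c2)).
  set (r := / (2 * lam)).
  assert (Hr : 0 < r) by (apply Rinv_0_lt_compat; lra).
  assert (big : forall u, r <= Rabs (u - u0) -> lam <= Rabs (c1 + 2 * c2 * u)).
  { intros u Hu. replace (c1 + 2 * c2 * u) with (2 * (c2 * (u - u0)))
      by (unfold u0; field; auto).
    rewrite !Rabs_mult, (Rabs_pos_eq 2), <- Hl2 by lra.
    replace lam with (2 * (lam * lam * r)) at 1 by (unfold r; field; lra).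
    apply Rmult_le_compat_l; [lra|]. apply Rmult_le_compat_l; nra. }
  (* cutting at [u0 - r] and [u0 + r] moved into [0, y] covers all positions
     of the stationary point; a piece that collapses contributes nothing *)
  set (clamp := fun v => Rmax 0 (Rmin v y)).
  set (p := clamp (u0 - r)). set (s := clamp (u0 + r)).
  assert (Hp : 0 <= p <= y /\ 0 <= s <= y /\ 0 <= s - p <= 2 * r /\
    (forall u, 0 <= u <= p -> p = 0 \/ r <= u0 - u) /\
    (forall u, s <= u <= y -> s = y \/ r <= u - u0)).
  { unfold p, s, clamp, Rmax, Rmin.
    repeat destruct Rle_dec; repeat split; try lra; intros u Hu;
      first [now left; lra | right; lra]. }
  destruct Hp as (Hp & Hs & Hps & H1 & H2).
  assert (B1 : Rabs (qcos_int c0 c1 c2 p - qcos_int c0 c1 c2 0) <= / lam).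
  { destruct (Req_dec p 0) as [E|E].
    - rewrite E, Rminus_diag, Rabs_R0. apply Rlt_le, Rinv_0_lt_compat, Hl.
    - apply qcos_int_first_derivative; auto; [lra|].
      intros u Hu. apply big. destruct (H1 u Hu); [lra|].
      rewrite Rabs_left1; lra. }
  assert (B2 : Rabs (qcos_int c0 c1 c2 s - qcos_int c0 c1 c2 p) <= / lam).
  { eapply Rle_trans; [apply qcos_int_lipschitz; lra|].
    replace (/ lam) with (2 * r) by (unfold r; field; lra). lra. }
  assert (B3 : Rabs (qcos_int c0 c1 c2 y - qcos_int c0 c1 c2 s) <= / lam).
  { destruct (Req_dec s y) as [E|E].
    - rewrite E, Rminus_diag, Rabs_R0. apply Rlt_le, Rinv_0_lt_compat, Hl.
    - apply qcos_int_first_derivative; auto; [lra|].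
      intros u Hu. apply big. destruct (H2 u Hu); [lra|].
      rewrite Rabs_pos_eq; lra. }
  rewrite qcos_int_0 in B1.
  apply Rabs_le_between in B1, B2, B3. apply Rabs_le.
  unfold Rdiv. lra.
Qed.

Lemma weyl_int_bound y c1 c2 :
  0 <= y -> c2 <> 0 -> Cmod (weyl_int y c1 c2) <= 6 / sqrt (Rabs c2).
Proof.
  intros Hy Hc. rewrite weyl_int_eq.
  eapply Rle_trans; [apply Cmod_le_Re_Im|]. simpl.
  assert (B1 := qcos_int_second_derivative 0 c1 c2 y Hy Hc).
  assert (B2 := qcos_int_second_derivative (- (1 / 4)) c1 c2 y Hy Hc).
  unfold Rdiv in *. lra.
Qed.

Lemma weyl_int_lipschitz y z c1 c2 :
  y <= z -> Cmod (weyl_int z c1 c2 - weyl_int y c1 c2)%C <= 2 * (z - y).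
Proof.
  intros H. rewrite !weyl_int_eq.
  eapply Rle_trans; [apply Cmod_le_Re_Im|]. simpl.
  assert (B1 := qcos_int_lipschitz 0 c1 c2 y z H).
  assert (B2 := qcos_int_lipschitz (- (1 / 4)) c1 c2 y z H).
  unfold Rminus in *. lra.
Qed.

(** * Comparing a sum with an integral *)

Lemma rsum_derive (f df : nat -> R -> R) n t :
  (forall k, is_derive (f k) t (df k t)) ->
  is_derive (fun t => rsum (fun k => f k t) n) t (rsum (fun k => df k t) n).
Proof.
  intros H. induction n as [|n IH].
  - rewrite rsum_0. apply (is_derive_ext (fun _ => 0)).
    + intros u. now rewrite rsum_0.
    + apply (is_derive_const (V := R_NormedModule)).
  - rewrite rsum_S. apply (is_derive_ext (fun t => rsum (fun k => f k t) n + f (S n) t)).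
    + intros u. now rewrite rsum_S.
    + apply (is_derive_plus (V := R_NormedModule) (fun t => rsum (fun k => f k t) n) (f (S n))); auto.
Qed.

Lemma mean_value_01 (f df : R -> R) s :
  0 < s -> (forall t, is_derive f t (df t)) ->
  exists c, 0 <= c <= s /\ f s - f 0 = df c * s.
Proof.
  intros Hs Hf. destruct (MVT_gen f 0 s df) as (c & Hc & E).
  - intros x _. apply Hf.
  - intros x _. apply continuity_pt_filterlim.
    apply (ex_derive_continuous (V := R_NormedModule) f x). exists (df x). apply Hf.
  - rewrite Rmin_left, Rmax_right in Hc by lra.
    exists c. split; [exact Hc|]. rewrite E. ring.
Qed.

(** Averaged over shifts [t] in [0, 1], the shifted sums of [g (x - t)] give the
    integral exactly.  Hence the integral is the value of such a sum at some [c],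
    and it differs from the unshifted sum by at most the supremum of the
    derivative in [t]. *)
Lemma sum_minus_integral (G g dg : R -> R) n M :
  (forall u, is_derive G u (g u)) ->
  (forall u, is_derive g u (dg u)) ->
  (forall t, 0 <= t <= 1 -> Rabs (rsum (fun x => dg (INR x - t)) n) <= M) ->
  Rabs (rsum (fun x => g (INR x)) n - (G (INR n) - G 0)) <= M.
Proof.
  intros HG Hg HM.
  set (K := fun t => rsum (fun x => G (INR x) - G (INR x - t)) n).
  set (H := fun t => rsum (fun x => g (INR x - t)) n).
  assert (K1 : K 1 - K 0 = G (INR n) - G 0).
  { unfold K. clear. induction n as [|n IH].
    - rewrite !rsum_0. simpl. ring.
    - rewrite !rsum_S. rewrite S_INR.
      replace (INR n + 1 - 1) with (INR n) by ring.
      replace (INR n + 1 - 0) with (INR n + 1) by ring. lra. }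
  destruct (mean_value_01 K H 1 ltac:(lra)) as (c & Hc & E).
  { intros t. apply (rsum_derive (fun x t => G (INR x) - G (INR x - t))
      (fun x t => g (INR x - t))).
    intros x. evar_last.
    - apply (is_derive_minus (V := R_NormedModule) (fun _ => G (INR x)) (fun t => G (INR x - t)));
        [apply (is_derive_const (V := R_NormedModule))|].
      apply (is_derive_comp G (fun t => INR x - t)); [apply HG|].
      auto_derive; [trivial|reflexivity].
    - unfold minus, plus, opp, scal, zero. simpl. unfold mult. simpl. ring. }
  assert (H0 : rsum (fun x => g (INR x)) n = H 0).
  { unfold H. apply rsum_ext. intros x. now rewrite Rminus_0_r. }
  rewrite <- K1, E, Rmult_1_r, H0.
  destruct (Req_dec c 0) as [C0|C0].
  - rewrite C0, Rminus_diag, Rabs_R0.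
    eapply Rle_trans; [apply Rabs_pos | apply (HM 0); lra].
  - destruct (mean_value_01 H (fun t => rsum (fun x => - dg (INR x - t)) n) c ltac:(lra))
      as (d & Hd & E').
    { intros t. apply (rsum_derive (fun x t => g (INR x - t))
        (fun x t => - dg (INR x - t))).
      intros x. evar_last.
      - apply (is_derive_comp g (fun t => INR x - t)); [apply Hg|].
        auto_derive; [trivial|reflexivity].
      - unfold minus, plus, opp, scal, zero. simpl. unfold mult. simpl. ring. }
    rewrite Rabs_minus_sym, E', Rabs_mult, (Rabs_pos_eq c) by lra.
    replace (rsum (fun x => - dg (INR x - d)) n)
      with (- rsum (fun x => dg (INR x - d)) n).
    2:{ transitivity (-1 * rsum (fun x => dg (INR x - d)) n); [ring|].
        rewrite <- rsum_mult_l. apply rsum_ext. intros x. ring. }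
    rewrite Rabs_Ropp. assert (A := HM d ltac:(lra)).
    assert (B := Rabs_pos (rsum (fun x => dg (INR x - d)) n)). nra.
Qed.

(** The derivative of the shifted sum is, up to a unimodular factor and passage to
    the imaginary part, the sum of
    [2 * PI * (qdiff k + c2) * e (d1 * k + c2 * k ^ 2)] with [d1 = c1 - 2 * c2 * t].
    The part with [qdiff k] is bounded by [qsum_weighted], and the part with [c2]
    trivially.  Smallness of [n * |c2|] keeps [qdiff k] within [9 / 16] of zero. *)
Lemma qcos_sum_minus_integral c0 c1 c2 n :
  Rabs c1 <= 1 / 2 -> INR n * Rabs c2 <= 1 / 64 ->
  Rabs (rsum (fun x => qcos c0 c1 c2 (INR x)) n - qcos_int c0 c1 c2 (INR n)) <= 40.
Proof.
  intros H1 H2. rewrite <- (Rminus_0_r (qcos_int c0 c1 c2 (INR n))).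
  rewrite <- (qcos_int_0 c0 c1 c2).
  apply (sum_minus_integral _ _ _ n 40 (qcos_int_derive c0 c1 c2) (qcos_derive c0 c1 c2)).
  intros t Ht.
  destruct n as [|m]; [rewrite rsum_0, Rabs_R0; lra|].
  set (n := S m) in *.
  assert (Hn : 1 <= INR n) by (change 1 with (INR 1); apply le_INR; unfold n; lia).
  assert (HP := PI_4). assert (HP0 := PI_RGT_0). assert (Hc2 := Rabs_pos c2).
  assert (Hc2' : Rabs c2 <= 1 / 64) by nra.
  set (d1 := c1 - 2 * c2 * t).
  set (A := csum (fun k => RtoC (2 * PI * qdiff d1 c2 k)
                       * e (d1 * INR k + c2 * INR k ^ 2))%C n).
  set (z := (e (c0 - c1 * t + c2 * t ^ 2) * (A + RtoC (2 * PI * c2) * qsum d1 c2 n))%C).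
  assert (E : rsum (fun x => - (2 * PI * (c1 + 2 * c2 * (INR x - t))) *
      sin (2 * PI * (c0 + c1 * (INR x - t) + c2 * (INR x - t) ^ 2))) n = - Im z).
  { unfold z, A, qsum. rewrite <- csum_mult_l, <- csum_plus, <- csum_mult_l, csum_Im.
    transitivity (-1 * rsum (fun k => Im (e (c0 - c1 * t + c2 * t ^ 2) *
   (RtoC (2 * PI * qdiff d1 c2 k) * e (d1 * INR k + c2 * INR k ^ 2) +
    RtoC (2 * PI * c2) * e (d1 * INR k + c2 * INR k ^ 2)))%C) n); [|ring].
    rewrite <- rsum_mult_l. apply rsum_ext. intros k.
    replace (e (c0 - c1 * t + c2 * t ^ 2) *
   (RtoC (2 * PI * qdiff d1 c2 k) * e (d1 * INR k + c2 * INR k ^ 2) +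
    RtoC (2 * PI * c2) * e (d1 * INR k + c2 * INR k ^ 2)))%C
     with (RtoC (2 * PI * (c1 + 2 * c2 * (INR k - t))) *
       e (c0 + c1 * (INR k - t) + c2 * (INR k - t) ^ 2))%C.
    - rewrite e_eq. unfold Im, Cmult, RtoC. simpl. ring.
    - replace (c0 + c1 * (INR k - t) + c2 * (INR k - t) ^ 2)
        with ((c0 - c1 * t + c2 * t ^ 2) + (d1 * INR k + c2 * INR k ^ 2))
        by (unfold d1; ring).
      rewrite (e_plus (c0 - c1 * t + c2 * t ^ 2)).
      replace (2 * PI * (c1 + 2 * c2 * (INR k - t)))
        with (2 * PI * qdiff d1 c2 k + 2 * PI * c2) by (unfold qdiff, d1; ring).
      rewrite RtoC_plus. ring. }
  rewrite E, Rabs_Ropp. eapply Rle_trans.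
  { eapply Rle_trans; [apply Rmax_r | apply Rmax_Cmod]. }
  unfold z. rewrite Cmod_mult, Cmod_e, Rmult_1_l.
  eapply Rle_trans; [apply Cmod_triangle|].
  rewrite Cmod_mult, Cmod_R, Rabs_mult, (Rabs_pos_eq (2 * PI)) by lra.
  assert (B1 : Cmod A <= 16 + 1280 * (INR n * Rabs c2)).
  { apply qsum_weighted. intros k Hk.
    assert (N := qdiff_near d1 c2 k n Hk ltac:(unfold n; lia)).
    assert (D : Rabs (2 * c2 * t) <= 2 * (1 / 64)).
    { rewrite !Rabs_mult, (Rabs_pos_eq 2), (Rabs_pos_eq t) by lra. nra. }
    assert (D1 : Rabs d1 <= 1 / 2 + 2 * (1 / 64)).
    { unfold d1. eapply Rle_trans; [apply Rabs_triang|]. rewrite Rabs_Ropp. lra. }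
    replace (qdiff d1 c2 k) with (d1 + (qdiff d1 c2 k - d1)) by ring.
    eapply Rle_trans; [apply Rabs_triang|]. lra. }
  assert (B2 : Cmod (qsum d1 c2 n) <= INR n * 1).
  { apply csum_bound. intros k _. rewrite Cmod_e. lra. }
  assert (B3 : 2 * PI * Rabs c2 * Cmod (qsum d1 c2 n) <= 8 * (1 / 64)).
  { apply Rle_trans with (2 * PI * Rabs c2 * INR n).
    - apply Rmult_le_compat_l; nra.
    - replace (2 * PI * Rabs c2 * INR n) with (2 * PI * (INR n * Rabs c2)) by ring.
      apply Rmult_le_compat; try lra. nra. }
  lra.
Qed.

Lemma qsum_minus_integral c1 c2 n :
  Rabs c1 <= 1 / 2 -> INR n * Rabs c2 <= 1 / 64 ->
  Cmod (qsum c1 c2 n - weyl_int (INR n) c1 c2)%C <= 80.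
Proof.
  intros H1 H2. eapply Rle_trans; [apply Cmod_le_Re_Im|].
  assert (B1 := qcos_sum_minus_integral 0 c1 c2 n H1 H2).
  assert (B2 := qcos_sum_minus_integral (- (1 / 4)) c1 c2 n H1 H2).
  unfold qsum. rewrite weyl_int_eq.
  replace (Re _) with (rsum (fun x => qcos 0 c1 c2 (INR x)) n - qcos_int 0 c1 c2 (INR n)).
  replace (Im _) with (rsum (fun x => qcos (- (1 / 4)) c1 c2 (INR x)) n
                       - qcos_int (- (1 / 4)) c1 c2 (INR n)).
  - lra.
  - change (Im (csum (fun x => e (c1 * INR x + c2 * INR x ^ 2)) n - (qcos_int 0 c1 c2 (INR n), qcos_int (- (1 / 4)) c1 c2 (INR n)))%C)
    with (Im (csum (fun x => e (c1 * INR x + c2 * INR x ^ 2)) n) - qcos_int (- (1 / 4)) c1 c2 (INR n)).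
    rewrite csum_Im. f_equal. apply rsum_ext. intros k. now rewrite e_qcos.
  - change (Re (csum (fun x => e (c1 * INR x + c2 * INR x ^ 2)) n - (qcos_int 0 c1 c2 (INR n), qcos_int (- (1 / 4)) c1 c2 (INR n)))%C)
    with (Re (csum (fun x => e (c1 * INR x + c2 * INR x ^ 2)) n) - qcos_int 0 c1 c2 (INR n)).
    rewrite csum_Re. f_equal. apply rsum_ext. intros k. now rewrite e_qcos.
Qed.

(** * Gauss sums and completion *)

Lemma INR_ge_1 q : (0 < q)%nat -> 1 <= INR q.
Proof. intros H. apply (le_INR 1). lia. Qed.

Lemma char_sum_dvd q m :
  (0 < q)%nat -> (Z.of_nat q | m)%Z ->
  csum (fun y => e (IZR m * INR y / INR q)) q = RtoC (INR q).
Proof.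
  intros Hq [k ->]. assert (Hq' := INR_ge_1 q Hq).
  rewrite (csum_ext _ (fun _ => RtoC 1)).
  - rewrite csum_const. ring.
  - intros y _. rewrite mult_IZR, <- INR_IZR_INZ.
    replace (IZR k * INR q * INR y / INR q) with (IZR (k * Z.of_nat y)).
    + apply e_IZR.
    + rewrite mult_IZR, <- INR_IZR_INZ. field. lra.
Qed.

(** Multiplication by [e (m / q)] shifts the index within the period, so it fixes the
    sum; and [e (m / q)] is [1] only if [q] divides [m]. *)
Lemma char_sum_ndvd q m :
  (0 < q)%nat -> ~ (Z.of_nat q | m)%Z ->
  csum (fun y => e (IZR m * INR y / INR q)) q = RtoC 0.
Proof.
  intros Hq Hm. assert (Hq' := INR_ge_1 q Hq).
  set (T := csum _ q).
  assert (E : (e (IZR m / INR q) * T)%C = T).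
  { unfold T at 2. rewrite <- (csum_period _ q 1).
    - unfold T. rewrite <- csum_mult_l. apply csum_ext. intros y _.
      rewrite <- e_plus. f_equal. rewrite plus_INR. simpl. field. lra.
    - intros k. rewrite plus_INR.
      replace (IZR m * (INR k + INR q) / INR q)
        with (IZR m * INR k / INR q + IZR m) by (field; lra).
      apply e_plus_IZR. }
  destruct (Ceq_dec T (RtoC 0)) as [H|H]; [exact H|exfalso].
  assert (E1 : Cmod (RtoC 1 - e (- (- (IZR m / INR q))))%C = 0).
  { rewrite Ropp_involutive.
    replace (RtoC 1 - e (IZR m / INR q))%C
      with ((T - e (IZR m / INR q) * T) * / T)%C by (field; auto).
    rewrite E. replace ((T - T) * / T)%C with (RtoC 0) by ring. apply Cmod_0. }
  rewrite Cmod_one_minus_e in E1.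
  assert (E2 : sin (PI * - (IZR m / INR q)) = 0).
  { apply Rabs_eq_0. lra. }
  apply sin_eq_0_0 in E2. destruct E2 as [k Hk].
  apply Hm. exists (- k)%Z. apply eq_IZR.
  rewrite mult_IZR, opp_IZR, <- INR_IZR_INZ.
  assert (HP := PI_RGT_0).
  assert (- (IZR m / INR q) = IZR k).
  { apply (Rmult_eq_reg_l PI); lra. }
  replace (IZR m) with (IZR m / INR q * INR q) by (field; lra). nra.
Qed.

Definition gauss_term (q : nat) (a1 a2 : Z) (x : nat) : C :=
  e ((IZR a1 * INR x + IZR a2 * INR x ^ 2) / INR q).

Lemma gauss_term_period q a1 a2 x :
  (0 < q)%nat -> gauss_term q a1 a2 (x + q) = gauss_term q a1 a2 x.
Proof.
  intros Hq. assert (Hq' := INR_ge_1 q Hq). unfold gauss_term.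
  symmetry. rewrite <- (e_plus_IZR _ (a1 + a2 * (2 * Z.of_nat x + Z.of_nat q))).
  f_equal.
  rewrite plus_IZR, mult_IZR, plus_IZR, mult_IZR, <- !INR_IZR_INZ, plus_INR.
  field. lra.
Qed.

Lemma gauss_sum_shift q a1 a2 x :
  (0 < q)%nat -> csum (fun k => gauss_term q a1 a2 (x + k)) q = gauss_sum q a1 a2.
Proof.
  intros Hq. apply (csum_period (gauss_term q a1 a2)). intros k.
  now apply gauss_term_period.
Qed.

Lemma gauss_sum_period q a1 a2 :
  (0 < q)%nat -> gauss_sum q (a1 + Z.of_nat q) a2 = gauss_sum q a1 a2.
Proof.
  intros Hq. assert (Hq' := INR_ge_1 q Hq). apply csum_ext. intros k _.
  rewrite <- (e_plus_IZR ((IZR a1 * _ + _) / _) (Z.of_nat k)). f_equal.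
  rewrite plus_IZR, <- !INR_IZR_INZ. field. lra.
Qed.

(** The doubles [2 * h] that are divisible by [p] are distinct multiples of [p]. *)
Lemma count_even_multiples p n :
  (0 < p)%nat ->
  rsum (fun h => if Nat.eqb ((2 * h) mod p) 0 then 1 else 0) n
  <= INR ((2 * n) / p).
Proof.
  intros Hp. induction n as [|n IH].
  - rewrite rsum_0. apply pos_INR.
  - rewrite rsum_S.
    assert (M : ((2 * n) / p <= (2 * S n) / p)%nat)
      by (apply Nat.Div0.div_le_mono; lia).
    destruct (Nat.eqb_spec ((2 * S n) mod p) 0) as [E|E].
    + assert (L : (S ((2 * n) / p) <= (2 * S n) / p)%nat).
      { apply Nat.Div0.div_exact in E. set (m := ((2 * S n) / p)%nat) in *.
        apply Nat.Div0.div_lt_upper_bound. lia. }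
      apply le_INR in L. rewrite S_INR in L. lra.
    + apply le_INR in M. lra.
Qed.

(** In the square of a Gauss sum the shift [h] survives only if [q] divides
    [2 * a * h], that is, if the reduced denominator [p = q / d] divides [2 * h]. *)
Lemma gcd_decompose q a :
  (0 < q)%nat ->
  exists d p : nat, (0 < p)%nat /\ q = (d * p)%nat /\ Z.of_nat d = Z.gcd (Z.of_nat q) a /\
    forall h : nat, (Z.of_nat q | 2 * a * Z.of_nat h)%Z -> ((2 * h) mod p = 0)%nat.
Proof.
  intros Hq. set (g := Z.gcd (Z.of_nat q) a).
  assert (Hg : (0 < g)%Z).
  { assert (0 <= g)%Z by apply Z.gcd_nonneg.
    assert (g <> 0)%Z by (intros E; apply Z.gcd_eq_0_l in E; lia). lia. }
  destruct (Z.gcd_divide_l (Z.of_nat q) a) as [p Ep].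
  destruct (Z.gcd_divide_r (Z.of_nat q) a) as [b Eb].
  fold g in Ep, Eb.
  assert (Hp : (0 < p)%Z) by nia.
  exists (Z.to_nat g), (Z.to_nat p).
  split; [lia|]. split; [apply Nat2Z.inj; rewrite Nat2Z.inj_mul, !Z2Nat.id by lia; lia|].
  split; [apply Z2Nat.id; lia|].
  intros h [k Hk].
  assert (R : Z.gcd p b = 1%Z).
  { assert (E : (g * Z.gcd p b)%Z = g).
    { rewrite <- Z.gcd_mul_mono_l_nonneg by lia.
      rewrite (Z.mul_comm g p), (Z.mul_comm g b), <- Ep, <- Eb. reflexivity. }
    nia. }
  assert (D : (p | 2 * Z.of_nat h)%Z).
  { apply (Z.gauss p b); [|exact R]. exists k.
    apply (Z.mul_cancel_l _ _ g); [lia|]. rewrite Ep, Eb in Hk. nia. }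
  destruct D as [m Hm].
  apply Nat.Div0.mod_divides. exists (Z.to_nat m). nia.
Qed.

(** In [S * conj S], rewrite [S] as a sum over [y + h] for each term [y] of [conj S].
    For fixed [h], the sum over [y] is then a complete character sum, which vanishes unless [q]
    divides [2 * a2 * h].  At most [2 d] values of [h] survive, each
    contributing [q]. *)
Lemma gauss_sum_bound q a1 a2 :
  (0 < q)%nat ->
  Cmod (gauss_sum q a1 a2) <= 2 * sqrt (IZR (Z.gcd (Z.of_nat q) a2) * INR q).
Proof.
  intros Hq. assert (Hq' := INR_ge_1 q Hq).
  destruct (gcd_decompose q a2 Hq) as (d & p & Hp & Ed & Eg & Hdvd).
  rewrite <- Eg, <- INR_IZR_INZ.
  set (S := gauss_sum q a1 a2).
  set (g := gauss_term q a1 a2).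
  assert (E : (S * Cconj S)%C =
    csum (fun h => g h * csum (fun y => e (IZR (2 * a2 * Z.of_nat h) * INR y / INR q)) q)%C q).
  { unfold S at 2. change (gauss_sum q a1 a2) with (csum g q).
    rewrite csum_conj, <- csum_mult_l.
    rewrite (csum_ext _ (fun y => csum (fun h => Cconj (g y) * g (y + h)%nat)%C q)).
    2:{ intros y _. rewrite csum_mult_l.
        unfold g at 3. rewrite gauss_sum_shift by exact Hq. apply Cmult_comm. }
    rewrite csum_switch. apply csum_ext. intros h _. rewrite <- csum_mult_l.
    apply csum_ext. intros y _. unfold g, gauss_term.
    rewrite <- e_opp, <- !e_plus. f_equal.
    rewrite !mult_IZR, <- INR_IZR_INZ, plus_INR. field. lra. }
  assert (B : Cmod S ^ 2 <= INR q * INR (2 * d)).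
  { replace (Cmod S ^ 2) with (Cmod (S * Cconj S)%C).
    2:{ rewrite Cmod_mult, Cmod_conj. ring. }
    rewrite E. eapply Rle_trans; [apply csum_triangle|].
    eapply Rle_trans; [apply rsum_le with
      (g := fun h => INR q * (if Nat.eqb ((2 * h) mod p) 0 then 1 else 0))|].
    - intros h _. rewrite Cmod_mult. unfold g, gauss_term. rewrite Cmod_e, Rmult_1_l.
      destruct (Zdivide_dec (Z.of_nat q) (2 * a2 * Z.of_nat h)) as [D|D].
      + rewrite char_sum_dvd, Cmod_R, Rabs_pos_eq by (auto; lra).
        rewrite (Hdvd h D). simpl. lra.
      + rewrite char_sum_ndvd, Cmod_0 by auto. destruct Nat.eqb; lra.
    - rewrite rsum_mult_l. apply Rmult_le_compat_l; [lra|].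
      eapply Rle_trans; [apply count_even_multiples, Hp|]. apply le_INR.
      rewrite Ed, Nat.mul_assoc, Nat.div_mul; lia. }
  rewrite mult_INR in B. simpl in B.
  apply Rsqr_incr_0_var.
  - rewrite Rsqr_mult, Rsqr_sqrt by (apply Rmult_le_pos; [apply pos_INR | lra]).
    unfold Rsqr. assert (H := pos_INR d). nra.
  - apply Rmult_le_pos; [lra | apply sqrt_pos].
Qed.

(** For each [x], detect the residue class of [x] in the Gauss sums by orthogonality.
    The Gauss sum is started at [x + 1], so that the surviving term is always the
    last one, [h = q]. *)
Lemma qsum_completion q a1 a2 b1 b2 n :
  (0 < q)%nat ->
  (RtoC (INR q) * qsum (IZR a1 / INR q + b1) (IZR a2 / INR q + b2) n)%C =
  csum (fun b => gauss_sum q (a1 + Z.of_nat b) a2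
                 * qsum (b1 - INR b / INR q) b2 n)%C q.
Proof.
  intros Hq. assert (Hq' := INR_ge_1 q Hq).
  unfold qsum at 1. rewrite <- csum_mult_l.
  rewrite (csum_ext (fun b => (gauss_sum q (a1 + Z.of_nat b) a2
                 * qsum (b1 - INR b / INR q) b2 n)%C)
    (fun b => csum (fun x => gauss_sum q (a1 + Z.of_nat b) a2
                 * e ((b1 - INR b / INR q) * INR x + b2 * INR x ^ 2))%C n)).
  2:{ intros b _. now rewrite csum_mult_l. }
  rewrite csum_switch. apply csum_ext. intros x _.
  set (c := e (b1 * INR x + b2 * INR x ^ 2)).
  rewrite (csum_ext _ (fun b => csum (fun h =>
     (c * gauss_term q a1 a2 (x + h)) * e (IZR (Z.of_nat h) * INR b / INR q))%C q)).
  2:{ intros b _. rewrite <- (gauss_sum_shift _ _ _ x Hq), Cmult_comm, <- csum_mult_l.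
      apply csum_ext. intros h _. unfold c, gauss_term. rewrite <- !e_plus. f_equal.
      rewrite plus_IZR, <- !INR_IZR_INZ, plus_INR. field. lra. }
  rewrite csum_switch.
  rewrite (csum_ext _ (fun h => c * gauss_term q a1 a2 (x + h) *
     csum (fun b => e (IZR (Z.of_nat h) * INR b / INR q)) q)%C).
  2:{ intros h _. apply csum_mult_l. }
  destruct q as [|p]; [lia|]. rewrite csum_S, char_sum_dvd by (auto; reflexivity).
  rewrite (csum_ext _ (fun _ => RtoC 0)).
  - rewrite csum_const, gauss_term_period by exact Hq. unfold c, gauss_term.
    replace ((IZR a1 / INR (S p) + b1) * INR x + (IZR a2 / INR (S p) + b2) * INR x ^ 2)
      with (b1 * INR x + b2 * INR x ^ 2
            + (IZR a1 * INR x + IZR a2 * INR x ^ 2) / INR (S p)) by (field; lra).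
    rewrite e_plus. ring.
  - intros h Hh. rewrite char_sum_ndvd; [ring | exact Hq |].
    intros D. apply Z.divide_pos_le in D; lia.
Qed.

(** The constant [2] pays for using [1 / k] in place of [1 / (k + 1)], which lets the
    same inequality serve the increasing and the decreasing harmonic sum below. *)
Lemma ln_step k : (1 <= k)%nat -> / INR k <= 2 * (ln (INR (S k)) - ln (INR k)).
Proof.
  intros Hk. assert (H := INR_ge_1 k Hk). rewrite S_INR.
  assert (L : ln (INR k / (INR k + 1)) <= - / (INR k + 1)).
  { assert (P : 0 < INR k / (INR k + 1)) by (apply Rdiv_lt_0_compat; lra).
    assert (X := exp_ineq1_le (ln (INR k / (INR k + 1)))). rewrite exp_ln in X by exact P.
    replace (- / (INR k + 1)) with (INR k / (INR k + 1) - 1) by (field; lra). lra. }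
  rewrite ln_div in L by lra.
  assert (/ INR k <= 2 * / (INR k + 1)).
  { replace (2 * / (INR k + 1)) with (/ ((INR k + 1) / 2)) by (field; lra).
    apply Rinv_le_contravar; lra. }
  lra.
Qed.

Lemma harmonic_sum_bound q m :
  (m < q)%nat ->
  rsum (fun b => / INR b + / INR (q - b)) m
  <= 2 * ln (INR (S m)) + 2 * (ln (INR q) - ln (INR (q - m))).
Proof.
  induction m as [|m IH]; intros Hm.
  - rewrite rsum_0, Nat.sub_0_r. simpl. rewrite ln_1. lra.
  - rewrite rsum_S. assert (H := IH ltac:(lia)).
    assert (S1 := ln_step (S m) ltac:(lia)).
    assert (S2 := ln_step (q - S m) ltac:(lia)).
    replace (S (q - S m)) with (q - m)%nat in S2 by lia. lra.
Qed.

(** The negated derivative of the phase stays within [3 / (4 q)] of [b / q].  As [b]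
    and [q - b] are at least [1], its distance to the integers remains at least
    [min (b, q - b) / (4 q)]. *)
Lemma qsum_nonprincipal q b b1 b2 n :
  (1 <= b < q)%nat ->
  Rabs b1 <= 1 / (2 * INR q) -> INR n * Rabs b2 <= 1 / (64 * INR q) ->
  Cmod (qsum (b1 - INR b / INR q) b2 n) <= 8 * INR q * (/ INR b + / INR (q - b)).
Proof.
  intros Hb H1 H2.
  assert (Hq := INR_ge_1 q ltac:(lia)). assert (Hb1 := INR_ge_1 b ltac:(lia)).
  assert (Hb2 := INR_ge_1 (q - b) ltac:(lia)).
  assert (I1 : 0 < / INR b) by (apply Rinv_0_lt_compat; lra).
  assert (I2 : 0 < / INR (q - b)) by (apply Rinv_0_lt_compat; lra).
  assert (Eqb : INR (q - b) = INR q - INR b) by (apply minus_INR; lia).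
  destruct n as [|n'].
  { unfold qsum. rewrite csum_0, Cmod_0. apply Rmult_le_pos; lra. }
  set (n := S n') in *.
  set (m := Rmin (INR b) (INR (q - b))).
  assert (Hm : 1 <= m) by (unfold m; apply Rmin_glb; lra).
  assert (Hm1 : m <= INR b) by apply Rmin_l.
  assert (Hm2 : m <= INR (q - b)) by apply Rmin_r.
  set (iq := / INR q).
  assert (Hiq : 0 < iq) by (apply Rinv_0_lt_compat; lra).
  assert (Eq : INR q * iq = 1) by (unfold iq; field; lra).
  replace (1 / (2 * INR q)) with (iq / 2) in H1 by (unfold iq; field; lra).
  replace (1 / (64 * INR q)) with (iq / 64) in H2 by (unfold iq; field; lra).
  set (mu := m * iq / 2).
  assert (Hmu : 0 < mu) by (unfold mu; nra).
  eapply Rle_trans; [apply (qsum_kusmin_landau _ _ n mu Hmu)|].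
  - intros k Hk. rewrite Cmod_one_minus_e.
    set (c1 := b1 - INR b / INR q).
    assert (D := qdiff_near c1 b2 k n Hk ltac:(unfold n; lia)).
    set (s := - qdiff c1 b2 k).
    assert (Es : s = INR b * iq - b1 - (qdiff c1 b2 k - c1)).
    { unfold s, c1, iq. field. lra. }
    apply Rabs_le_between in H1.
    assert (D' : Rabs (qdiff c1 b2 k - c1) <= iq / 32) by lra.
    apply Rabs_le_between in D'.
    assert (L1 : m * iq / 4 <= s) by nra.
    assert (L2 : m * iq / 4 <= 1 - s) by nra.
    assert (Ls := sin_PI_lower s ltac:(nra) ltac:(nra)).
    assert (m * iq / 4 <= Rmin s (1 - s)) by (apply Rmin_glb; lra).
    replace (qdiff c1 b2 k) with (- s) by (unfold s; ring).
    replace (PI * - s) with (- (PI * s)) by ring.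
    rewrite sin_neg, Rabs_Ropp, Rabs_pos_eq by nra. unfold mu. lra.
  - assert (Emu : / mu = 2 * INR q * / m) by (unfold mu, iq; field; lra).
    assert (Im : / m <= / INR b + / INR (q - b)).
    { unfold m, Rmin. destruct Rle_dec; lra. }
    assert (Im1 : / m <= 1) by (rewrite <- Rinv_1; apply Rinv_le_contravar; lra).
    assert (Im0 : 0 < / m) by (apply Rinv_0_lt_compat; lra).
    replace (INR n * (32 * Rabs b2 / mu ^ 2)) with (32 * (INR n * Rabs b2) * (/ mu * / mu))
      by (field; lra).
    assert (32 * (INR n * Rabs b2) * (/ mu * / mu) <= / mu).
    { apply Rle_trans with (iq / 2 * (/ mu * / mu)).
      - apply Rmult_le_compat_r; [|lra]. rewrite Emu. nra.
      - rewrite Emu. replace (iq / 2 * (2 * INR q * / m * (2 * INR q * / m)))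
          with ((INR q * iq) * (2 * INR q * / m * / m)) by (field; lra). rewrite Eq. nra.  }
    rewrite Emu in *. nra.
Qed.

(** * Short sums: major arc approximation *)

(** The allowed error for sums over which [beta2 * x ^ 2] does not oscillate. *)
Definition err (q : nat) (a2 : Z) : R :=
  sqrt (IZR (Z.gcd (Z.of_nat q) a2) * INR q) * ln (2 * INR q).

Lemma err_bounds q a2 :
  (0 < q)%nat ->
  1 <= sqrt (IZR (Z.gcd (Z.of_nat q) a2) * INR q) /\ 1 / 2 <= ln (2 * INR q).
Proof.
  intros Hq. assert (Hq' := INR_ge_1 q Hq). split.
  - rewrite <- sqrt_1. apply sqrt_le_1_alt.
    assert (G : (1 <= Z.gcd (Z.of_nat q) a2)%Z).
    { assert (0 <= Z.gcd (Z.of_nat q) a2)%Z by apply Z.gcd_nonneg.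
      assert (Z.gcd (Z.of_nat q) a2 <> 0)%Z by (intros E; apply Z.gcd_eq_0_l in E; lia).
      lia. }
    apply IZR_le in G. nra.
  - assert (L := ln_lt_2). assert (ln 2 <= ln (2 * INR q)) by (apply ln_le; lra). lra.
Qed.

Lemma err_ge_half q a2 : (0 < q)%nat -> 1 / 2 <= err q a2.
Proof. intros Hq. destruct (err_bounds q a2 Hq). unfold err. nra. Qed.

Lemma gauss_sum_err q a1 a2 :
  (0 < q)%nat -> Cmod (gauss_sum q a1 a2) <= 4 * err q a2.
Proof.
  intros Hq. eapply Rle_trans; [apply gauss_sum_bound, Hq|].
  destruct (err_bounds q a2 Hq). unfold err. nra.
Qed.

Lemma main_term_bound q a1 a2 z :
  (0 < q)%nat ->
  Cmod (/ RtoC (INR q) * gauss_sum q a1 a2 * z)%C <= 4 * err q a2 * (/ INR q * Cmod z).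
Proof.
  intros Hq. assert (Hq' := INR_ge_1 q Hq).
  assert (G := gauss_sum_err q a1 a2 Hq).
  assert (I : 0 < / INR q) by (apply Rinv_0_lt_compat; lra).
  rewrite !Cmod_mult, <- RtoC_inv, Cmod_R, (Rabs_pos_eq (/ INR q)) by lra.
  assert (H := Cmod_ge_0 z).
  replace (/ INR q * Cmod (gauss_sum q a1 a2) * Cmod z)
    with (Cmod (gauss_sum q a1 a2) * (/ INR q * Cmod z)) by ring.
  apply Rmult_le_compat_r; [nra | exact G].
Qed.

(** In the completed sum, the term [b = q] is the Gauss sum times [qsum b1 b2 n],
    which is replaced by the integral.  The other terms are a harmonic sum. *)
Lemma short_sum_approx q a1 a2 b1 b2 n :
  (0 < q)%nat -> Rabs b1 <= 1 / (2 * INR q) -> INR n * Rabs b2 <= 1 / (64 * INR q) ->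
  Cmod (qsum (IZR a1 / INR q + b1) (IZR a2 / INR q + b2) n
        - / RtoC (INR q) * gauss_sum q a1 a2 * weyl_int (INR n) b1 b2)%C
  <= 400 * err q a2.
Proof.
  intros Hq H1 H2. assert (Hq' := INR_ge_1 q Hq).
  assert (I : 0 < / INR q) by (apply Rinv_0_lt_compat; lra).
  assert (I1 : / INR q <= 1) by (rewrite <- Rinv_1; apply Rinv_le_contravar; lra).
  assert (Hc := qsum_completion q a1 a2 b1 b2 n Hq).
  destruct q as [|p]; [lia|]. set (q := S p) in *.
  unfold q in Hc at 6. rewrite csum_S in Hc. fold q in Hc.
  rewrite gauss_sum_period in Hc by exact Hq.
  replace (qsum (b1 - INR q / INR q) b2 n) with (qsum b1 b2 n) in Hc.
  2:{ apply csum_ext. intros x _. rewrite <- (e_plus_IZR _ (- Z.of_nat x)). f_equal.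
      rewrite opp_IZR, <- INR_IZR_INZ. field. lra. }
  set (U := csum _ p) in Hc.
  set (A := gauss_sum q a1 a2) in *.
  assert (nz : RtoC (INR q) <> RtoC 0) by (intros E; apply RtoC_inj in E; lra).
  set (B := 2 * sqrt (IZR (Z.gcd (Z.of_nat q) a2) * INR q)).
  destruct (err_bounds q a2 Hq) as [E1 E2].
  assert (HB : 0 <= B) by (unfold B; lra).
  assert (HA : Cmod A <= B) by (apply gauss_sum_bound, Hq).
  assert (HU : Cmod U <= B * (8 * INR q * (4 * ln (INR q)))).
  { eapply Rle_trans; [apply csum_triangle|].
    eapply Rle_trans; [apply rsum_le with
      (g := fun b => (B * (8 * INR q)) * (/ INR b + / INR (q - b)))|].
    - intros b Hb. rewrite Cmod_mult, Rmult_assoc.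
      apply Rmult_le_compat; try apply Cmod_ge_0.
      + apply gauss_sum_bound, Hq.
      + apply qsum_nonprincipal; auto. unfold q. lia.
    - rewrite rsum_mult_l, Rmult_assoc. apply Rmult_le_compat_l; [exact HB|].
      apply Rmult_le_compat_l; [lra|].
      eapply Rle_trans; [apply harmonic_sum_bound; unfold q; lia|].
      fold q. replace (q - p)%nat with 1%nat by (unfold q; lia).
      simpl (INR 1). rewrite ln_1. lra. }
  replace (qsum (IZR a1 / INR q + b1) (IZR a2 / INR q + b2) n
           - / RtoC (INR q) * A * weyl_int (INR n) b1 b2)%C
    with (/ RtoC (INR q) * (U + A * (qsum b1 b2 n - weyl_int (INR n) b1 b2)))%C.
  2:{ transitivity (/ RtoC (INR q) * (U + A * qsum b1 b2 n)
        - / RtoC (INR q) * A * weyl_int (INR n) b1 b2)%C; [ring|].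
      rewrite <- Hc. field. exact nz. }
  rewrite Cmod_mult, <- RtoC_inv, Cmod_R, (Rabs_pos_eq (/ INR q)) by lra.
  assert (HF : Cmod (qsum b1 b2 n - weyl_int (INR n) b1 b2)%C <= 80).
  { apply qsum_minus_integral.
    - eapply Rle_trans; [exact H1|]. unfold Rdiv. rewrite Rinv_mult. nra.
    - eapply Rle_trans; [exact H2|]. unfold Rdiv. rewrite Rinv_mult. nra. }
  assert (HT : Cmod (U + A * (qsum b1 b2 n - weyl_int (INR n) b1 b2))%C
               <= B * (8 * INR q * (4 * ln (INR q))) + B * 80).
  { eapply Rle_trans; [apply Cmod_triangle|]. rewrite Cmod_mult.
    assert (Cmod A * Cmod (qsum b1 b2 n - weyl_int (INR n) b1 b2)%C <= B * 80).
    { apply Rmult_le_compat; auto; apply Cmod_ge_0. }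
    lra. }
  assert (Hl : ln (INR q) <= ln (2 * INR q)) by (apply ln_le; lra).
  apply Rle_trans with (/ INR q * (B * (8 * INR q * (4 * ln (INR q))) + B * 80)).
  { apply Rmult_le_compat_l; lra. }
  replace (/ INR q * (B * (8 * INR q * (4 * ln (INR q))) + B * 80))
    with (B * (32 * ln (INR q) + 80 * / INR q)) by (field; lra).
  unfold err. fold q.
  replace (400 * (sqrt (IZR (Z.gcd (Z.of_nat q) a2) * INR q) * ln (2 * INR q)))
    with (B * (200 * ln (2 * INR q))) by (unfold B; ring).
  apply Rmult_le_compat_l; lra.
Qed.

(** * Long sums: subdivision *)

Lemma nearest_fraction q c :
  (0 < q)%nat -> exists a : Z, Rabs (c - IZR a / INR q) <= 1 / (2 * INR q).
Proof.
  intros Hq. assert (Hq' := INR_ge_1 q Hq).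
  exists (Int_part (INR q * c + 1 / 2)).
  destruct (base_Int_part (INR q * c + 1 / 2)) as [L1 L2].
  set (z := IZR (Int_part (INR q * c + 1 / 2))) in *.
  replace (c - z / INR q) with ((INR q * c - z) * / INR q) by (field; lra).
  assert (I : 0 < / INR q) by (apply Rinv_0_lt_compat; lra).
  rewrite Rabs_mult, (Rabs_pos_eq (/ INR q)) by lra.
  replace (1 / (2 * INR q)) with (1 / 2 * / INR q) by (field; lra).
  apply Rmult_le_compat_r; [lra|]. apply Rabs_le. lra.
Qed.

Lemma qsum_trivial c1 c2 n : Cmod (qsum c1 c2 n) <= INR n.
Proof.
  rewrite <- (Rmult_1_r (INR n)). apply csum_bound. intros k _. rewrite Cmod_e. lra.
Qed.

(** A translation by [L] turns the linear coefficient into [c1 + 2 * c2 * L] and keeps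
    [c2], which is why the bound on pieces is needed for all [c1] at once. *)
Lemma qsum_subdivide c2 L B :
  (1 <= L)%nat ->
  (forall c1 n, (n <= L)%nat -> Cmod (qsum c1 c2 n) <= B) ->
  forall n c1, Cmod (qsum c1 c2 n) <= (INR n / INR L + 1) * B.
Proof.
  intros HL H. assert (HL' := INR_ge_1 L HL).
  assert (HB : 0 <= B).
  { eapply Rle_trans; [apply Cmod_ge_0 | apply (H 0 0%nat); lia]. }
  induction n as [n IH] using lt_wf_ind. intros c1.
  destruct (le_lt_dec n L) as [Hn|Hn].
  - apply Rle_trans with (1 * B); [rewrite Rmult_1_l; auto|].
    apply Rmult_le_compat_r; [exact HB|].
    assert (0 <= INR n / INR L).
    { apply Rmult_le_pos; [apply pos_INR | apply Rlt_le, Rinv_0_lt_compat; lra]. }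
    lra.
  - replace n with (L + (n - L))%nat at 1 by lia.
    unfold qsum. rewrite csum_add. eapply Rle_trans; [apply Cmod_triangle|].
    assert (B1 := H c1 L (le_n L)). unfold qsum in B1.
    assert (B2 := IH (n - L)%nat ltac:(lia) (c1 + 2 * c2 * INR L)).
    rewrite (csum_ext (fun k => e (c1 * INR (L + k) + c2 * INR (L + k) ^ 2))
      (fun k => e (c1 * INR L + c2 * INR L ^ 2) *
                e ((c1 + 2 * c2 * INR L) * INR k + c2 * INR k ^ 2))%C).
    2:{ intros k _. rewrite <- e_plus. f_equal. rewrite plus_INR. ring. }
    rewrite csum_mult_l, Cmod_mult, Cmod_e, Rmult_1_l.
    fold (qsum (c1 + 2 * c2 * INR L) c2 (n - L)).
    rewrite minus_INR in B2 by lia.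
    replace ((INR n - INR L) / INR L) with (INR n / INR L - 1) in B2 by (field; lra).
    lra.
Qed.

Lemma nat_between x : 1 <= x -> exists L : nat, (1 <= L)%nat /\ x / 2 <= INR L <= x.
Proof.
  intros Hx. destruct (base_Int_part x) as [L1 L2].
  assert (P : (1 <= Int_part x)%Z).
  { assert (IZR 0 < IZR (Int_part x)) by lra. apply lt_IZR in H. lia. }
  exists (Z.to_nat (Int_part x)). split; [lia|].
  rewrite INR_IZR_INZ, Z2Nat.id by lia.
  apply IZR_le in P. lra.
Qed.

(** The main term of size [sqrt (d / q) / sqrt |b2|] dominates the error of the short
    approximation exactly because [q * sqrt |b2| <= 1]. *)
Lemma qsum_piece_small q a2 b2 n c1 :
  (0 < q)%nat -> 0 < Rabs b2 -> INR q * sqrt (Rabs b2) <= 1 ->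
  INR n * Rabs b2 <= 1 / (64 * INR q) ->
  Cmod (qsum c1 (IZR a2 / INR q + b2) n) <= 424 * (err q a2 / (INR q * sqrt (Rabs b2))).
Proof.
  intros Hq Hb2 Hs Hn. assert (Hq' := INR_ge_1 q Hq).
  assert (Hl : 0 < sqrt (Rabs b2)) by now apply sqrt_lt_R0.
  set (l := sqrt (Rabs b2)) in *.
  assert (He := err_ge_half q a2 Hq).
  destruct (nearest_fraction q c1 Hq) as [a1 Ha1].
  assert (M := short_sum_approx q a1 a2 (c1 - IZR a1 / INR q) b2 n Hq Ha1 Hn).
  replace (IZR a1 / INR q + (c1 - IZR a1 / INR q)) with c1 in M by ring.
  set (b1 := c1 - IZR a1 / INR q) in *.
  assert (W : Cmod (weyl_int (INR n) b1 b2) <= 6 / l).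
  { apply weyl_int_bound; [apply pos_INR|]. intros E. rewrite E, Rabs_R0 in Hb2. lra. }
  assert (T := main_term_bound q a1 a2 (weyl_int (INR n) b1 b2) Hq).
  set (m := (/ RtoC (INR q) * gauss_sum q a1 a2 * weyl_int (INR n) b1 b2)%C) in *.
  set (F := qsum c1 (IZR a2 / INR q + b2) n) in *.
  replace F with ((F - m) + m)%C by ring.
  eapply Rle_trans; [apply Cmod_triangle|].
  assert (I : 0 < / INR q) by (apply Rinv_0_lt_compat; lra).
  assert (J : 1 <= / (INR q * l)).
  { rewrite <- Rinv_1. apply Rinv_le_contravar; nra. }
  assert (/ INR q * Cmod (weyl_int (INR n) b1 b2) <= 6 * / (INR q * l)).
  { replace (6 * / (INR q * l)) with (/ INR q * (6 / l)) by (field; lra).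
    apply Rmult_le_compat_l; lra. }
  unfold Rdiv. nra.
Qed.

(** With a nearest fraction [a1 / q] to [c1], the factor [e (b1 * k + b2 * k ^ 2)] has
    bounded variation on the piece, since [n / q] and [n ^ 2 * |b2|] are bounded.
    What remains is an incomplete Gauss sum of length [O(q)], to which
    [short_sum_approx] applies with [b1 = b2 = 0]. *)
Lemma qsum_piece_large q a2 b2 n c1 :
  (0 < q)%nat -> INR n <= 64 * INR q -> INR n ^ 2 * Rabs b2 <= 1 ->
  Cmod (qsum c1 (IZR a2 / INR q + b2) n) <= 1000000 * err q a2.
Proof.
  intros Hq Hn Hb2. assert (Hq' := INR_ge_1 q Hq).
  assert (He := err_ge_half q a2 Hq).
  assert (I : 0 < / INR q) by (apply Rinv_0_lt_compat; lra).
  destruct (nearest_fraction q c1 Hq) as [a1 Ha1].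
  set (b1 := c1 - IZR a1 / INR q) in *.
  set (w := fun k : nat => e (b1 * INR k + b2 * INR k ^ 2)).
  set (g := fun k : nat => e (IZR a1 / INR q * INR k + IZR a2 / INR q * INR k ^ 2)).
  assert (HG : forall j, (j <= n)%nat -> Cmod (csum g j) <= 1000 * err q a2).
  { intros j Hj. apply le_INR in Hj.
    assert (P : 0 <= 1 / (2 * INR q) /\ 0 <= 1 / (64 * INR q)).
    { split; apply Rlt_le, Rdiv_lt_0_compat; lra. }
    assert (M := short_sum_approx q a1 a2 0 0 j Hq
      ltac:(rewrite Rabs_R0; lra) ltac:(rewrite Rabs_R0; lra)).
    rewrite !Rplus_0_r in M.
    assert (T := main_term_bound q a1 a2 (weyl_int (INR j) 0 0) Hq).
    assert (W : Cmod (weyl_int (INR j) 0 0) <= 2 * INR j).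
    { assert (W := weyl_int_lipschitz 0 (INR j) 0 0 (pos_INR j)).
      rewrite (weyl_int_eq 0), !qcos_int_0 in W. change (0, 0) with (RtoC 0) in W.
      replace (weyl_int (INR j) 0 0 - RtoC 0)%C with (weyl_int (INR j) 0 0) in W by ring.
      lra. }
    assert (/ INR q * Cmod (weyl_int (INR j) 0 0) <= 128).
    { apply Rle_trans with (/ INR q * (128 * INR q)).
      - apply Rmult_le_compat_l; lra.
      - right. field. lra. }
    change (csum g j) with (qsum (IZR a1 / INR q) (IZR a2 / INR q) j).
    set (m := (/ RtoC (INR q) * gauss_sum q a1 a2 * weyl_int (INR j) 0 0)%C) in *.
    set (F := qsum (IZR a1 / INR q) (IZR a2 / INR q) j) in *.
    replace F with ((F - m) + m)%C by ring.
    eapply Rle_trans; [apply Cmod_triangle|]. nra. }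
  unfold qsum. rewrite (csum_ext _ (fun k => w k * g k)%C).
  2:{ intros k _. unfold w, g. rewrite <- e_plus. f_equal. unfold b1. ring. }
  destruct n as [|n'].
  { rewrite csum_0, Cmod_0. lra. }
  set (n := S n') in *.
  assert (V : forall k, (k < n)%nat ->
    Cmod (w (S k) - w k)%C <= 16 * (Rabs b1 + 2 * (INR n * Rabs b2))).
  { intros k Hk. eapply Rle_trans; [apply e_lipschitz|].
    apply Rmult_le_compat_l; [lra|].
    replace (b1 * INR (S k) + b2 * INR (S k) ^ 2 - (b1 * INR k + b2 * INR k ^ 2))
      with (b1 + (qdiff b1 b2 (S k) - b1)) by (unfold qdiff; rewrite S_INR; ring).
    eapply Rle_trans; [apply Rabs_triang|].
    assert (Q := qdiff_near b1 b2 (S k) n Hk ltac:(unfold n; lia)). lra. }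
  assert (A := abel_bound g w n _ 1 _ HG ltac:(unfold w; rewrite Cmod_e; lra) V).
  eapply Rle_trans; [exact A|].
  assert (T : INR n * Rabs b1 <= 32).
  { apply Rle_trans with (64 * INR q * (1 / (2 * INR q))).
    - apply Rmult_le_compat; try lra; [apply pos_INR | apply Rabs_pos].
    - right. field. lra. }
  replace (INR n * (16 * (Rabs b1 + 2 * (INR n * Rabs b2))))
    with (16 * (INR n * Rabs b1) + 32 * (INR n ^ 2 * Rabs b2)) by ring.
  nra.
Qed.

(** If [64 * q * sqrt |b2| < 1], the hypothesis says that [n] exceeds the length of
    the pieces, so their number is comparable to [n] divided by that length.
    Otherwise the one extra piece is absorbed by the summand [1]. *)
Lemma qsum_long q a2 b2 n c1 :
  (0 < q)%nat -> 1 < 64 * INR q * (INR n * Rabs b2) ->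
  Cmod (qsum c1 (IZR a2 / INR q + b2) n)
  <= 2000000 * (err q a2 * (1 + INR n * sqrt (Rabs b2))).
Proof.
  intros Hq Hn. assert (Hq' := INR_ge_1 q Hq).
  assert (He := err_ge_half q a2 Hq). assert (Hn0 := pos_INR n).
  assert (Hb2 : 0 < Rabs b2).
  { destruct (Rabs_pos b2) as [H|H]; [exact H|]. rewrite <- H in Hn. lra. }
  assert (Hl : 0 < sqrt (Rabs b2)) by now apply sqrt_lt_R0.
  assert (Hl2 : sqrt (Rabs b2) * sqrt (Rabs b2) = Rabs b2) by (apply sqrt_sqrt; lra).
  set (l := sqrt (Rabs b2)) in *.
  assert (Hnl : 0 <= INR n * l) by nra.
  assert (Hen : 0 <= err q a2 * (INR n * l)) by nra.
  (* for [|b2| > 1] even the trivial bound is good enough *)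
  destruct (Rlt_dec 1 l) as [C1|C1].
  { eapply Rle_trans; [apply qsum_trivial|]. nra. }
  destruct (Rlt_dec (64 * INR q * l) 1) as [C2|C2].
  - set (x := / (64 * INR q * Rabs b2)).
    assert (Hx0 : 0 < 64 * INR q * Rabs b2) by nra.
    assert (Hx : 1 <= x).
    { unfold x. rewrite <- Rinv_1. apply Rinv_le_contravar; [exact Hx0|].
      rewrite <- Hl2. nra. }
    destruct (nat_between x Hx) as (L & HL & HL1 & HL2).
    assert (HL' := INR_ge_1 L HL).
    assert (P := qsum_subdivide (IZR a2 / INR q + b2) L
      (424 * (err q a2 / (INR q * l))) HL).
    eapply Rle_trans; [apply P|].
    { intros c m Hm. apply qsum_piece_small; auto; [fold l; nra|].
      apply le_INR in Hm.
      apply Rle_trans with (x * Rabs b2).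
      - apply Rmult_le_compat_r; lra.
      - right. unfold x. field. split; lra. }
    assert (R : INR n / INR L + 1 <= 192 * INR q * (INR n * Rabs b2)).
    { assert (/ INR L <= 128 * INR q * Rabs b2).
      { replace (128 * INR q * Rabs b2) with (/ (x / 2)) by (unfold x; field; split; lra).
        apply Rinv_le_contravar; lra. }
      unfold Rdiv. nra. }
    apply Rle_trans with
      (192 * INR q * (INR n * Rabs b2) * (424 * (err q a2 / (INR q * l)))).
    + apply Rmult_le_compat_r; [|exact R].
      apply Rmult_le_pos; [lra|]. apply Rlt_le, Rdiv_lt_0_compat; nra.
    + rewrite <- Hl2.
      replace (192 * INR q * (INR n * (l * l)) * (424 * (err q a2 / (INR q * l))))
        with (81408 * (err q a2 * (INR n * l))) by (field; lra).
      lra.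
  - set (x := / l).
    assert (Hx : 1 <= x).
    { unfold x. rewrite <- Rinv_1. apply Rinv_le_contravar; lra. }
    destruct (nat_between x Hx) as (L & HL & HL1 & HL2).
    assert (HL' := INR_ge_1 L HL).
    assert (Hxl : x * l = 1) by (unfold x; field; lra).
    assert (P := qsum_subdivide (IZR a2 / INR q + b2) L (1000000 * err q a2) HL).
    eapply Rle_trans; [apply P|].
    { intros c m Hm. apply le_INR in Hm. assert (Hm0 := pos_INR m).
      apply qsum_piece_large; auto.
      - nra.
      - rewrite <- Hl2. assert (INR m * l <= 1) by nra.
        assert (0 <= INR m * l) by nra.
        replace (INR m ^ 2 * (l * l)) with ((INR m * l) * (INR m * l)) by ring. nra. }
    assert (R : INR n / INR L <= 2 * (INR n * l)).
    { assert (/ INR L <= 2 * l).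
      { replace (2 * l) with (/ (x / 2)) by (unfold x; field; lra).
        apply Rinv_le_contravar; lra. }
      unfold Rdiv. nra. }
    nra.
Qed.

(** When the short case does not apply, the sum and the main term are both within
    the error, so they are bounded separately. *)
Lemma qsum_approx q a1 a2 b1 b2 n :
  (0 < q)%nat -> Rabs b1 <= 1 / (2 * INR q) ->
  Cmod (qsum (IZR a1 / INR q + b1) (IZR a2 / INR q + b2) n
        - / RtoC (INR q) * gauss_sum q a1 a2 * weyl_int (INR n) b1 b2)%C
  <= 3000000 * (err q a2 * (1 + INR n * sqrt (Rabs b2))).
Proof.
  intros Hq H1. assert (Hq' := INR_ge_1 q Hq).
  assert (He := err_ge_half q a2 Hq). assert (Hn0 := pos_INR n).
  assert (Hl := sqrt_pos (Rabs b2)).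
  assert (Hl2 : sqrt (Rabs b2) * sqrt (Rabs b2) = Rabs b2)
    by apply sqrt_sqrt, Rabs_pos.
  set (l := sqrt (Rabs b2)) in *.
  assert (Hen : 0 <= err q a2 * (INR n * l)).
  { apply Rmult_le_pos; [lra|]. now apply Rmult_le_pos. }
  destruct (Rlt_dec 1 (64 * INR q * (INR n * Rabs b2))) as [C|C].
  - assert (HF := qsum_long q a2 b2 n (IZR a1 / INR q + b1) Hq C). fold l in HF.
    assert (Hl' : 0 < l).
    { destruct Hl as [Hl|Hl]; [exact Hl|]. rewrite <- Hl2, <- Hl in C. lra. }
    assert (W : Cmod (weyl_int (INR n) b1 b2) <= 6 / l).
    { apply weyl_int_bound; auto. intros E. rewrite <- Hl2 in C.
      rewrite E, Rabs_R0 in Hl2. rewrite Hl2 in C. lra. }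
    assert (T := main_term_bound q a1 a2 (weyl_int (INR n) b1 b2) Hq).
    assert (/ INR q * Cmod (weyl_int (INR n) b1 b2) <= 384 * (INR n * l)).
    { apply Rle_trans with (/ INR q * (6 / l)).
      - apply Rmult_le_compat_l; [|exact W]. apply Rlt_le, Rinv_0_lt_compat; lra.
      - apply (Rmult_le_reg_l (INR q * l)); [nra|].
        replace (INR q * l * (/ INR q * (6 / l))) with 6 by (field; lra).
        replace (INR q * l * (384 * (INR n * l)))
          with (6 * (64 * INR q * (INR n * (l * l)))) by ring.
        rewrite Hl2. lra. }
    eapply Rle_trans; [apply Cmod_triangle|]. rewrite Cmod_opp. nra.
  - assert (C' : INR n * Rabs b2 <= 1 / (64 * INR q)).
    { apply (Rmult_le_reg_l (64 * INR q)); [lra|].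
      replace (64 * INR q * (1 / (64 * INR q))) with 1 by (field; lra). lra. }
    eapply Rle_trans; [apply short_sum_approx; auto|]. nra.
Qed.

(** The sum ends at the integer part of [X]; prolonging the integral from there to
    [X] costs at most [O(sqrt (d q))].  Multiplying [err] by
    [sqrt (1 + X ^ 2 * |beta2|)] gives the stated bound. *)
Theorem theorem2p1 :
  exists K : R, 0 < K /\
    forall (X : R) (a1 a2 : Z) (q : nat) (alpha1 alpha2 : R),
      0 < X -> (0 < q)%nat ->
      let beta1 := alpha1 - IZR a1 / INR q in
      let beta2 := alpha2 - IZR a2 / INR q in
      Rabs beta1 <= 1 / (2 * INR q) ->
      Cmod (weyl_sum X alpha1 alpha2
            - / RtoC (INR q) * gauss_sum q a1 a2 * weyl_int X beta1 beta2)%C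
      <= K * sqrt (IZR (Z.gcd (Z.of_nat q) a2))
           * sqrt (INR q + INR q * X ^ 2 * Rabs beta2) * ln (2 * INR q).
Proof.
  exists 8000000. split; [lra|].
  intros X a1 a2 q alpha1 alpha2 HX Hq b1 b2 Hb1.
  assert (Hq' := INR_ge_1 q Hq). assert (He := err_ge_half q a2 Hq).
  destruct (base_Int_part X) as [F1 F2].
  assert (FP : (0 <= Int_part X)%Z).
  { assert (H : IZR (-1) < IZR (Int_part X)) by lra. apply lt_IZR in H. lia. }
  set (n := Z.to_nat (Int_part X)).
  assert (En : INR n = IZR (Int_part X)).
  { unfold n. now rewrite INR_IZR_INZ, Z2Nat.id. }
  assert (Hn := pos_INR n).
  assert (M := qsum_approx q a1 a2 b1 b2 n Hq Hb1).
  replace (IZR a1 / INR q + b1) with alpha1 in M by (unfold b1; ring).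
  replace (IZR a2 / INR q + b2) with alpha2 in M by (unfold b2; ring).
  change (weyl_sum X alpha1 alpha2) with (qsum alpha1 alpha2 n).
  assert (T := main_term_bound q a1 a2
    (weyl_int X b1 b2 - weyl_int (INR n) b1 b2)%C Hq).
  assert (W := weyl_int_lipschitz (INR n) X b1 b2 ltac:(lra)).
  set (F := qsum alpha1 alpha2 n) in *.
  set (S := (/ RtoC (INR q) * gauss_sum q a1 a2)%C) in *.
  replace (F - S * weyl_int X b1 b2)%C
    with ((F - S * weyl_int (INR n) b1 b2)
          + - (S * (weyl_int X b1 b2 - weyl_int (INR n) b1 b2)))%C by ring.
  eapply Rle_trans; [apply Cmod_triangle|]. rewrite Cmod_opp.
  assert (I : 0 < / INR q <= 1).
  { split; [apply Rinv_0_lt_compat; lra|]. rewrite <- Rinv_1.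
    apply Rinv_le_contravar; lra. }
  assert (T' : / INR q * Cmod (weyl_int X b1 b2 - weyl_int (INR n) b1 b2)%C <= 1 * 2).
  { apply Rmult_le_compat; try lra. apply Cmod_ge_0. }
  assert (Hl := sqrt_pos (Rabs b2)).
  assert (Hl2 : sqrt (Rabs b2) * sqrt (Rabs b2) = Rabs b2)
    by apply sqrt_sqrt, Rabs_pos.
  set (l := sqrt (Rabs b2)) in *.
  set (Y := sqrt (1 + X ^ 2 * Rabs b2)).
  assert (HXl : 0 <= X * l) by nra.
  assert (Y1 : 1 <= Y).
  { rewrite <- sqrt_1. apply sqrt_le_1_alt. rewrite <- Hl2. nra. }
  assert (Y2 : X * l <= Y).
  { rewrite <- (sqrt_square (X * l)) by exact HXl. apply sqrt_le_1_alt.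
    rewrite <- Hl2. nra. }
  replace (8000000 * sqrt (IZR (Z.gcd (Z.of_nat q) a2))
           * sqrt (INR q + INR q * X ^ 2 * Rabs b2) * ln (2 * INR q))
    with (8000000 * (err q a2 * Y)).
  2:{ unfold err, Y.
      replace (INR q + INR q * X ^ 2 * Rabs b2) with (INR q * (1 + X ^ 2 * Rabs b2)) by ring.
      assert (0 <= X ^ 2 * Rabs b2) by (rewrite <- Hl2; nra).
      assert (0 <= IZR (Z.gcd (Z.of_nat q) a2)) by apply IZR_le, Z.gcd_nonneg.
      rewrite !sqrt_mult by lra. ring. }
  assert (INR n * l <= X * l) by (apply Rmult_le_compat_r; lra).
  assert (err q a2 * (1 + INR n * l) <= err q a2 * (2 * Y))
    by (apply Rmult_le_compat_l; lra).
  assert (err q a2 * 1 <= err q a2 * Y) by (apply Rmult_le_compat_l; lra).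
  nra.
Qed.
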